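(* Let $c_1>0$. There are constants $c>0$ (sufficiently small) and $c'>0$, where $c'$ may depend only on $c_1$ and the fixed parameters $\alpha,C,\sigma_-,\sigma_+$ (and not on $n,\varepsilon,\delta$), such that if $0<\varepsilon<1$, $0<\delta<cn^{-2}$ and $n\varepsilon\ge c_1$, then $$\inf_{\hat f\in\mathcal M_{\varepsilon,\delta}}\ \sup_{f\in\tilde W(\alpha,C)}\mathbb E\left[\int_0^1(\hat f(x)-f(x))^2\,dx\right]\ \ge\ c'\left(n^{-\frac{2\alpha}{2\alpha+1}}+(n\varepsilon)^{-\frac{2\alpha}{\alpha+1}}\right).$$
   Context: Nonparametric regression: $(Y_i,X_i)$, $i\in[n]$, are i.i.d. with $Y_i=f(X_i)+\xi_i$, $X_i\sim U[0,1]$, and $\xi_i\sim N(0,\sigma^2)$ independent of $X_i$; the noise level $\sigma$ is a fixed constant with $0<\sigma_-\le\sigma\le\sigma_+<\infty$. $\alpha\ge1$ is a fixed integer and $C>0$ a fixed radius. The periodic Sobolev class is $$\tilde W(\alpha,C)=\Big\{f:[0,1]\to\mathbb R:\ \int_0^1\big(f(x)^2+(f^{(\alpha)}(x))^2\big)dx\le C^2,\ f^{(j)}(0)=f^{(j)}(1),\ 0\le j\le\alpha-1\Big\};$$ equivalently, $f=\sum_j\theta_j\varphi_j$ with $\varphi_1=1$, $\varphi_{2k}(t)=\sqrt2\cos(2\pi kt)$, $\varphi_{2k+1}(t)=\sqrt2\sin(2\pi kt)$ and $\sum_j\tau_j^2\theta_j^2\le C^2$, where $\tau_1=1$, $\tau_{2k}=\tau_{2k+1}=\sqrt{1+(2\pi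 k)^{2\alpha}}$. Differential privacy: a randomized algorithm $M$ is $(\varepsilon,\delta)$-differentially private if for every two data sets $D,D'$ of size $n$ differing by replacement of one record $(Y_i,X_i)$ and every measurable $S$, $\mathbb P(M(D)\in S)\le e^\varepsilon\mathbb P(M(D')\in S)+\delta$ (probability over $M$ only). $\mathcal M_{\varepsilon,\delta}$ is the class of all such algorithms with values in $L^2[0,1]$. The expectation is over the data and the randomness of $\hat f$. *)

(* Defs.v *)
From HB Require Import structures.
From mathcomp Require Import all_boot all_order all_algebra.
From mathcomp Require Import all_classical all_reals all_analysis.
From mathcomp Require Import measurable_realfun.

Set Implicit Arguments.
Unset Strict Implicit.
Unset Printing Implicit Defensive.

Import Order.TTheory GRing.Theory Num.Theory.
Import numFieldNormedType.Exports.

Local Open Scope classical_set_scope.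
Local Open Scope ring_scope.

Definition itv01 (R : realType) : set (measurableTypeR R) := `[0, 1].
Arguments itv01 {R}.

Definition leb01 (R : realType) : {measure set (measurableTypeR R) -> \bar R} :=
  mrestr lebesgue_measure (measurable_itv `[(0 : R), 1] : measurable itv01).

Definition ise (R : realType) (g f : R -> R) : \bar R :=
  \int[lebesgue_measure]_(x in itv01) ((g x - f x) ^+ 2)%:E.

(* Elements are classes of a.e.-equal functions; the coercion to functions
   picks a Borel representative. *)
Definition L2_class (R : realType) : Type := LspaceType2 (leb01 R).

Definition L2_zero_class (R : realType) :
    {mfun_ (leb01 R), (measurableTypeR R) >-> measurableTypeR R} :=
  \pi_({mfun_ (leb01 R), (measurableTypeR R) >-> measurableTypeR R})%qT
    (cst 0 : {mfun (measurableTypeR R) >-> (measurableTypeR R)}).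

Lemma L2_zero_class_ae (R : realType) :
  L2_zero_class R = cst 0 %[ae leb01 R].
Proof.
have /eqP := reprK (L2_zero_class R).
by rewrite /L2_zero_class eqmodE => /asboolP.
Qed.

Lemma L2_zero_finite (R : realType) :
  finite_norm (leb01 R) 2%:R%:E (L2_zero_class R).
Proof.
rewrite /finite_norm unlock.
pose f : measurableTypeR R -> R := L2_zero_class R.
have mf : measurable_fun setT f.
  by exact: (measurable_funPT (repr (L2_zero_class R))).
rewrite (_ : (\int[_]_x _)%E = (\int[leb01 R]_x (`|(f x)%:E| `^ 2))%E) //.
rewrite (ae_eq_integral (cst 0%E)) //.
- by rewrite integral0 poweR0r ?ltry// invr_neq0.
- have m0 : measurable_fun setT (EFin \o f) by exact/measurable_EFinP.
  have m1 := measurableT_comp (@abse_measurable R setT) m0.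
  exact: (measurableT_comp (measurable_poweR 2) m1).
- have := @L2_zero_class_ae R; apply: filterS => x /(_ I) fx0 _.
  by rewrite /= (fx0 : f x = 0) normr0 powR0 ?pnatr_eq0.
Qed.

HB.instance Definition _ (R : realType) := isFinLebesgue.Build _ _ _ (leb01 R)
  2%:R%:E (lee1n 2) (L2_zero_class R) (@L2_zero_finite R).

Definition L2_zero (R : realType) : L2_class R := L2_zero_class R.

HB.instance Definition _ (R : realType) := gen_eqMixin (L2_class R).
HB.instance Definition _ (R : realType) := gen_choiceMixin (L2_class R).
HB.instance Definition _ (R : realType) := isPointed.Build (L2_class R) (L2_zero R).

(* Openness for the L^2[0,1] norm; [ise] is the squared distance. *)
Definition L2_open (R : realType) : set (set (L2_class R)) :=
  fun A => forall g : L2_class R, A g ->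
    exists2 r : R, 0 < r &
      forall h : L2_class R, (ise h g < (r ^+ 2)%:E)%E -> A h.

(* L^2[0,1] with its Borel sigma-algebra. *)
Definition L2 (R : realType) : measurableType _ :=
  g_sigma_algebraType (@L2_open R).

Definition cons_pair d (T : measurableType d) n (z : T * n.-tuple T) :
  n.+1.-tuple T := [tuple of z.1 :: z.2].

Lemma measurable_cons_pair d (T : measurableType d) n :
  measurable_fun [set: T * n.-tuple T] (@cons_pair d T n).
Proof. exact: measurable_cons. Qed.

HB.instance Definition _ d (T : measurableType d) n :=
  isMeasurableFun.Build _ _ _ _ (@cons_pair d T n) (@measurable_cons_pair d T n).

Fixpoint iid d (T : measurableType d) (R : realType) (P : probability T R)
    (n : nat) : probability (n.-tuple T) R :=
  match n with
  | 0 => \d_ ([tuple] : 0.-tuple T)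
  | m.+1 => distribution (P \x iid P m)%E (@cons_pair d T m)
  end.

Lemma iid_setX d (T : measurableType d) (R : realType) (P : probability T R)
    (n : nat) (A : 'I_n -> set T) :
  (forall i, measurable (A i)) ->
  (iid P n [set t | forall i, A i (tnth t i)] = \prod_(i < n) P (A i))%E.
Proof.
elim: n A => [|n IHn] A mA.
  by rewrite big_ord0 /= diracE mem_set// => -[].
rewrite big_ord_recl -IHn// -product_measure1E//; last first.
  rewrite (_ : [set _ | _] = \bigcap_(i in [set: 'I_n])
      ((fun t : n.-tuple T => tnth t i) @^-1` A (lift ord0 i))).
    apply: fin_bigcap_measurable => // i _; rewrite -[X in measurable X]setTI.
    exact: measurable_tnth.
  by apply/seteqP; split => t /= At i; [move=> _; exact: At|exact: (At i I)].
rewrite /distribution /pushforward/=; congr product_measure1.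
apply/seteqP; split => -[x t] /=.
  move=> At; split; first exact: (At ord0).
  by move=> i; have := At (lift ord0 i); rewrite tnthS.
move=> [A0 At] i; case: (unliftP ord0 i) => [j|] -> //.
by rewrite tnthS; exact: At.
Qed.

(* Data sets hold records (Y_i, X_i); the underlying randomness is held in
   pairs (X_i, xi_i), from which [sample] produces the records. *)
Notation obs R := (measurableTypeR R * measurableTypeR R)%type.

Section regression.
Context (R : realType).
Implicit Types (f : R -> R) (n : nat).

Definition design_noise (sigma : R) : probability (obs R) R :=
  (uniform_prob (@ltr01 R) \x normal_prob (0 : R) sigma)%E.

Definition sample n f (w : n.-tuple (obs R)) : n.-tuple (obs R) :=
  [tuple of map (fun z : obs R => (f z.1 + z.2, z.1)) w].

(* Design points live in [0,1]: only such data sets are subject to the privacy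
   constraint. *)
Definition in_data_space n (D : n.-tuple (obs R)) : Prop :=
  forall i, itv01 (tnth D i).2.

Definition neighbors n (D D' : n.-tuple (obs R)) : Prop :=
  exists i, forall j, j != i -> tnth D j = tnth D' j.

(* A randomized algorithm is a Markov kernel; [M D] is the law of its output. *)
Definition diff_private n (eps delta : R)
    (M : R.-pker (n.-tuple (obs R)) ~> (L2 R)) : Prop :=
  forall D D' : n.-tuple (obs R), in_data_space D -> in_data_space D' ->
    neighbors D D' -> forall S : set (L2 R), measurable S ->
    (M D S <= (expR eps)%:E * M D' S + delta%:E)%E.

Definition risk n (sigma : R) (M : R.-pker (n.-tuple (obs R)) ~> (L2 R)) f
    : \bar R :=
  \int[iid (design_noise sigma) n]_w \int[M (sample f w)]_g ise g f.

(* F is absolutely continuous on [0,1] with a.e. derivative G. *)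
Definition weak_deriv (F G : R -> R) : Prop :=
  (lebesgue_measure : {measure set (measurableTypeR R) -> \bar R}).-integrable
    itv01 (EFin \o G) /\
  forall x, itv01 x -> F x = F 0 + \int[lebesgue_measure]_(t in `[0, x]) G t.

(* Functions on [0,1] are represented by functions on R whose values off [0,1]
   are irrelevant. [D j] is the j-th derivative: the existence of the chain says
   that the derivatives of order < alpha are absolutely continuous on [0,1] and
   that the top one exists a.e. *)
Definition periodic_sobolev (alpha : nat) (C : R) : set (R -> R) :=
  [set f | exists2 D : nat -> R -> R, D 0%N = f &
    [/\ forall j, (j < alpha)%N -> weak_deriv (D j) (D j.+1),
        forall j, (j < alpha)%N -> D j 0 = D j 1 &
        (\int[lebesgue_measure]_(x in itv01)
           ((f x) ^+ 2 + (D alpha x) ^+ 2)%:E <= (C ^+ 2)%:E)%E]].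

Definition private_minimax_risk n (sigma eps delta : R) (alpha : nat) (C : R)
    : \bar R :=
  ereal_inf [set ereal_sup [set risk sigma M f | f in periodic_sobolev alpha C]
            | M in @diff_private n eps delta].

End regression.

(* Main.v *)
From HB Require Import structures.
Require Import Defs.
From mathcomp Require Import all_boot all_order all_algebra.
From mathcomp Require Import all_classical all_reals all_analysis.
From mathcomp Require Import measurable_realfun.
From mathcomp Require Import ring lra.

(** The bound is an Assouad argument over a cube of 2^k regression functions.
    Cut [0,1] into k bins of length 1/k and put on the j-th bin a smooth bump
    psi_j of height of order k^-alpha that vanishes to order alpha at both ends
    of the bin. Whatever the signs, f_th = sum_j (+-) psi_j is periodic, and its
    alpha-th derivative is bounded uniformly in k and the signs, by a multiple
    of a constant h in the height of the bumps; for small h it lies in the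
    Sobolev ball ([signed_bumps_sobolev]). As the supports are disjoint, the
    squared error splits over the bins: an estimate g pays at least the integral of psi_j^2, of order k^(-2 alpha - 1), for every j at
    which the sign of the pairing of g with psi_j disagrees with the sign of
    f_th ([ise_signed_sum]). The set of such g is a Borel set of L^2, hence a
    test of the sign at j. If no test of the form M(.)(S) can tell th from
    th with one sign flipped, i.e. if its mean changes by at most 1/2, then
    averaging over th shows that some f_th has risk of order
    k * k^(-2 alpha - 1) = k^(-2 alpha) ([assouad_risk]).

    There are two reasons why a test cannot see one flipped sign. Flipping the
    j-th sign only moves the observations whose design point falls in the j-th
    bin, an event of probability 1/k, and moves those by a distance s of order
    k^-alpha in units of the noise.

    Without privacy: say that P has chi-square bound A relative to Q when
    (E_P u)^2 <= A E_Q u^2 for all test functions u. For two normal laws this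
    holds with A = exp(distance^2 / variance) ([chi2_le_normal]); averaging over
    the design gives A = 1 + O(s^2 / k) for one observation ([chi2_le_obs]), and
    Fubini raises A to the power n for n observations ([chi2_le_iid]). So n
    observations do not separate the hypotheses once k^(2 alpha + 1) >= n
    ([two_points_chi2]).

    With privacy: a test M(.)(S) changes by at most rho = e^eps - 1 + delta when
    one record is replaced. Exchanging the records one at a time, each exchange
    of the law of one record changes the mean by at most rho times the total
    variation distance, which is O(s / k); summing gives O(n eps k^(-alpha - 1))
    ([hybrid_bound], [le_obs_slices]). So the test fails once
    k^(alpha + 1) >= n eps ([two_points_private]). Taking c = c1 ensures
    delta <= c1 / n^2 <= eps, so that rho is O(eps).

    The smallest k allowed by the first reason gives the rate
    n^(-2 alpha / (2 alpha + 1)), the smallest one allowed by the second gives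
    (n eps)^(-2 alpha / (alpha + 1)); the hypothesis n eps >= c1 keeps the
    rounding of k to an integer harmless ([bin_number]). The larger of the two
    bounds is at least half of their sum. *)

Set Implicit Arguments.
Unset Strict Implicit.
Unset Printing Implicit Defensive.

Import Order.TTheory GRing.Theory Num.Theory.
Import numFieldNormedType.Exports.

Local Open Scope classical_set_scope.
Local Open Scope ring_scope.

(** * Scalar inequalities *)

Lemma expR_le_1D2x (R : realType) (t : R) : 0 <= t <= 1 / 2 ->
  expR t <= 1 + 2 * t.
Proof.
move=> /andP[t0 t2]; have h := expR_ge1Dx (- t).
have t1 : 0 < 1 - t by lra.
rewrite -[t in expR t]opprK expRN.
apply: (@le_trans _ _ (1 - t)^-1); first by rewrite lef_pV2 ?posrE ?expR_gt0.
rewrite -(ler_pM2l t1) divff ?gt_eqF//; nra.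
Qed.

Lemma expR_le_1D3x (R : realType) (t : R) : 0 <= t <= 1 -> expR t <= 1 + 3 * t.
Proof.
move=> /andP[t0 t1]; have -> : t = t / 2 + t / 2 by lra.
have /expR_le_1D2x h : 0 <= t / 2 <= 1 / 2 by lra.
by rewrite expRD; have := expR_gt0 (t / 2); nra.
Qed.

(** The Cauchy-Schwarz bound p^2 <= A q and the family of its linearisations
    2 l p <= l^2 A + q. The latter is linear in (p, A, q), hence is preserved
    under averaging, which is how the quadratic bound is integrated below. *)
Lemma sqr_le_linear (R : realType) (A p q : R) : 0 < A ->
  (forall l, 2 * l * p <= l ^+ 2 * A + q) -> p ^+ 2 <= A * q.
Proof.
move=> A0 /(_ (p / A)); rewrite -(ler_pM2l A0) mulrDr.
have -> : A * (2 * (p / A) * p) = 2 * p ^+ 2 by field; rewrite gt_eqF.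
have -> : A * ((p / A) ^+ 2 * A) = p ^+ 2 by field; rewrite gt_eqF.
lra.
Qed.

Lemma linear_le_sqr (R : realType) (A p q l : R) : 0 < A -> p ^+ 2 <= A * q ->
  2 * l * p <= l ^+ 2 * A + q.
Proof.
move=> A0 pq; rewrite -(ler_pM2l A0).
apply: (@le_trans _ _ (p ^+ 2 + (A * l) ^+ 2)).
  by have := sqr_ge0 (p - A * l); rewrite sqrrB; lra.
have -> : A * (l ^+ 2 * A + q) = A * q + (A * l) ^+ 2 by ring.
by rewrite lerD2r.
Qed.

(** * Means of test functions *)

(** Randomised tests. Being bounded, they are integrable for every probability,
    so their means can be computed in R rather than in the extended reals. *)
Definition testfun d (T : measurableType d) (R : realType) (u : T -> R) :=
  measurable_fun setT u /\ forall x, 0 <= u x <= 1.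

Section tests.
Context d (T : measurableType d) (R : realType).
Implicit Types (P Q : probability T R) (u v : T -> R).

Lemma test_emeasurable u : testfun u -> measurable_fun setT (EFin \o u).
Proof. by case=> u_meas _; exact/measurable_EFinP. Qed.

Lemma test_EFin_ge0 u x : testfun u -> (0 <= (u x)%:E)%E.
Proof. by move=> [_ u01]; rewrite lee_fin; case/andP: (u01 x). Qed.

Lemma bounded_integrable (mu : {finite_measure set T -> \bar R}) D u M :
  measurable D -> measurable_fun D u ->
  (forall x, D x -> `|u x| <= M) ->
  mu.-integrable D (EFin \o u).
Proof.
move=> mD u_meas uM; apply: measurable_bounded_integrable => //.
  by rewrite ltey_eq fin_num_measure.
by exists M; split; [exact: num_real|move=> N MN x /uM /le_trans; apply; exact: ltW].
Qed.

Lemma test_integrable P D u : measurable D -> testfun u -> P.-integrable D (EFin \o u).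
Proof.
move=> mD [u_meas u01]; apply: (@bounded_integrable _ _ _ 1) => //.
  exact: measurable_funTS.
by move=> x _; have /andP[u0 u1] := u01 x; rewrite ger0_norm.
Qed.

Lemma test_EFin P u : testfun u -> (\int[P]_x u x)%:E = (\int[P]_x (u x)%:E)%E.
Proof.
move=> tu; rewrite /Rintegral fineK//; apply: integrable_fin_num => //.
exact: test_integrable.
Qed.

Lemma Rintegral_prob_cst P r : \int[P]_x (cst r x) = r.
Proof. by rewrite Rintegral_cst// [X in fine X]probability_setT mulr1. Qed.

Lemma Rintegral_test P u : testfun u -> 0 <= \int[P]_x u x <= 1.
Proof.
move=> tu; apply/andP; split.
  by apply: Rintegral_ge0 => x _; case/andP: (tu.2 x).
rewrite -(Rintegral_prob_cst P 1); apply: le_Rintegral => //.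
- exact: test_integrable.
- exact: finite_measure_integrable_cst.
- by move=> x _; case/andP: (tu.2 x).
Qed.

Lemma le_Rintegral_test P u v : testfun u -> testfun v -> (forall x, u x <= v x) ->
  \int[P]_x u x <= \int[P]_x v x.
Proof.
by move=> tu tv uv; apply: le_Rintegral => //; apply: test_integrable.
Qed.

Lemma test_cst r : 0 <= r <= 1 -> testfun (cst r : T -> R).
Proof. by split. Qed.

Lemma test_sqr u : testfun u -> testfun (fun x => u x ^+ 2).
Proof.
move=> [u_meas u01]; split; first exact: measurable_funX.
by move=> x; have /andP[u0 u1] := u01 x; rewrite sqr_ge0/= expr_le1.
Qed.

Lemma test_indic (A : set T) : measurable A -> testfun (\1_A : T -> R).
Proof.
move=> mA; split; first exact: measurable_indic.
by move=> x; rewrite indicE; case: (x \in A); rewrite ?lexx ler01.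
Qed.

Lemma integrable_affine P u a b : testfun u ->
  P.-integrable setT (EFin \o (fun x => a + b * u x)).
Proof.
move=> tu; apply: (@bounded_integrable _ _ _ (`|a| + `|b|)) => //.
  by apply: measurable_funD => //; apply: measurable_funM => //; exact: tu.1.
move=> x _; rewrite (le_trans (ler_normD _ _))// lerD2l normrM ler_piMr//.
by have /andP[u0 u1] := tu.2 x; rewrite ger0_norm.
Qed.

Lemma test_affine u a b : testfun u -> (forall x, 0 <= a + b * u x <= 1) ->
  testfun (fun x => a + b * u x).
Proof.
move=> [u_meas u01] ?; split => //; apply: measurable_funD => //.
exact: measurable_funM.
Qed.

Lemma Rintegral_affine P u a b : testfun u ->
  \int[P]_x (a + b * u x) = a + b * \int[P]_x u x.
Proof.
move=> tu; rewrite RintegralD//; first last.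
- under eq_fun do rewrite -[_ * _]add0r; exact: integrable_affine.
- exact: finite_measure_integrable_cst.
rewrite RintegralZl//; last exact: test_integrable.
by rewrite [X in X + _](Rintegral_prob_cst P a).
Qed.

End tests.

Lemma test_comp d1 d2 (T1 : measurableType d1) (T2 : measurableType d2)
    (R : realType) (f : T1 -> T2) (u : T2 -> R) : measurable_fun setT f ->
  testfun u -> testfun (fun x => u (f x)).
Proof. by move=> mf [u_meas u01]; split => //; exact: measurableT_comp. Qed.

Lemma test_section d1 d2 (T1 : measurableType d1) (T2 : measurableType d2)
    (R : realType) (u : T1 * T2 -> R) x : testfun u -> testfun (fun y => u (x, y)).
Proof. exact: test_comp. Qed.

Lemma test_marginal d1 d2 (T1 : measurableType d1) (T2 : measurableType d2)
    (R : realType) (Q : probability T2 R) (u : T1 * T2 -> R) :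
  testfun u -> testfun (fun x => \int[Q]_y u (x, y)).
Proof.
move=> tu; split => [|x]; last by apply: Rintegral_test; exact: test_section.
apply/measurable_EFinP.
rewrite (_ : _ \o _ = fubini_F Q (EFin \o u)); last first.
  by apply/funext => x /=; rewrite test_EFin//; exact: test_section.
apply: measurable_fun_fubini_tonelli_F; first exact: test_emeasurable.
by move=> z; exact: test_EFin_ge0.
Qed.

Lemma Rintegral_prod d1 d2 (T1 : measurableType d1) (T2 : measurableType d2)
    (R : realType) (P : probability T1 R) (Q : probability T2 R)
    (u : T1 * T2 -> R) : testfun u ->
  \int[(P \x Q)%E]_z u z = \int[P]_x \int[Q]_y u (x, y).
Proof.
move=> tu; apply: EFin_inj; rewrite !test_EFin//; last exact: test_marginal.
rewrite fubini_tonelli1.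
- by apply: eq_integral => x _; rewrite test_EFin//; exact: test_section.
- exact: test_emeasurable.
- by move=> z; exact: test_EFin_ge0.
Qed.

Lemma Rintegral_distribution d1 d2 (T1 : measurableType d1)
    (T2 : measurableType d2) (R : realType) (P : probability T1 R)
    (f : {mfun T1 >-> T2}) (u : T2 -> R) : testfun u ->
  \int[distribution P f]_y u y = \int[P]_x u (f x).
Proof.
move=> tu; apply: EFin_inj; rewrite !test_EFin//; last exact: test_comp.
rewrite ge0_integral_distribution//; first exact: test_emeasurable.
by move=> z; exact: test_EFin_ge0.
Qed.

Section iid_tests.
Context d (T : measurableType d) (R : realType).
Implicit Types (P Q : probability T R) (n : nat).

Lemma test_cons n (u : n.+1.-tuple T -> R) :
  testfun u -> testfun (fun z : T * n.-tuple T => u (cons_pair z)).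
Proof. by apply: test_comp; exact: measurable_cons_pair. Qed.

Lemma test_cons_marginal Q n (u : n.+1.-tuple T -> R) : testfun u ->
  testfun (fun x => \int[iid Q n]_t u (cons_pair (x, t))).
Proof. by move=> /test_cons /test_marginal; exact. Qed.

Lemma test_cons_section n (u : n.+1.-tuple T -> R) x : testfun u ->
  testfun (fun t => u (cons_pair (x, t))).
Proof. by move=> /test_cons /test_section; exact. Qed.

Lemma Rintegral_iid0 P (u : 0.-tuple T -> R) :
  testfun u -> \int[iid P 0]_t u t = u [tuple].
Proof.
move=> tu; apply: EFin_inj; rewrite test_EFin// integral_dirac ?diracT ?mul1e//.
exact: test_emeasurable.
Qed.

Lemma Rintegral_iidS P n (u : n.+1.-tuple T -> R) : testfun u ->
  \int[iid P n.+1]_t u t = \int[P]_x \int[iid P n]_t u (cons_pair (x, t)).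
Proof.
move=> tu; rewrite [LHS]Rintegral_distribution// Rintegral_prod//.
exact: test_cons.
Qed.

(** * Chi-square bounds and their tensorisation *)

(** [A] bounds 1 plus the chi-square divergence of [P] from [Q], which is the
    least such constant. Quantifying over test functions avoids densities, and
    makes the bound on products a matter of iterated integration. *)
Definition chi2_le P Q (A : R) :=
  forall u, testfun u -> (\int[P]_x u x) ^+ 2 <= A * \int[Q]_x (u x ^+ 2).

(** Freeze the first coordinate and apply the bound to the others, then apply
    it to the first one. *)
Lemma chi2_le_iid P Q A n : 0 <= A -> chi2_le P Q A ->
  forall u : n.-tuple T -> R, testfun u ->
  (\int[iid P n]_t u t) ^+ 2 <= A ^+ n * \int[iid Q n]_t (u t ^+ 2).
Proof.
move=> A0 PQ; elim: n => [|n IH] u tu.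
  by rewrite !Rintegral_iid0 ?mul1r//; exact: test_sqr.
rewrite !Rintegral_iidS//; last exact: test_sqr.
pose U x := \int[iid P n]_t u (cons_pair (x, t)).
pose V x := \int[iid Q n]_t (u (cons_pair (x, t)) ^+ 2).
have tU : testfun U by exact: test_cons_marginal.
have tV : testfun V by apply: (test_cons_marginal _ (test_sqr tu)).
apply: le_trans (PQ U tU) _.
rewrite exprS -mulrA ler_wpM2l//.
rewrite -RintegralZl//; last exact: test_integrable.
apply: le_Rintegral => //.
- by apply: test_integrable => //; exact: test_sqr.
- have := @integrableZl _ _ _ Q _ measurableT (A ^+ n) _
    (test_integrable Q measurableT tV).
  exact.
- by move=> x _; apply: IH; exact: test_cons_section.
Qed.

(** The total variation distance is at most the square root of the chi-square
    divergence. The hypothesis is applied to 1 + s v, a perturbation of the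
    constant 1: with p, q the means of v under P, Q it yields
    2 (1 + s p) <= A + 1 + 2 s q + s^2. *)
Lemma chi2_le_TV P Q (A s : R) : 0 < s -> A <= 1 + s ^+ 2 -> chi2_le P Q A ->
  forall v, testfun v -> \int[P]_x v x <= \int[Q]_x v x + s.
Proof.
move=> s0 As PQ v tv.
have /andP[v0 v1] : 0 <= \int[P]_x v x <= 1 by exact: Rintegral_test.
have /andP[w0 w1] : 0 <= \int[Q]_x v x <= 1 by exact: Rintegral_test.
have s1 : 0 < 1 + s by rewrite addr_gt0.
(* normalises 1 + s v to a function with values in [0, 1] *)
pose c := (1 + s)^-1.
have c0 : 0 < c by rewrite invr_gt0.
have [c_ge0 s_ge0] := (ltW c0, ltW s0).
have cE : c * (1 + s) = 1 by rewrite mulVf// gt_eqF.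
have tw : testfun (fun x => c + (c * s) * v x).
  apply: test_affine => // x; have /andP[vx0 vx1] := tv.2 x.
  rewrite addr_ge0 ?mulr_ge0//=.
  have : c * s * v x <= c * s by rewrite ler_piMr// mulr_ge0.
  by move: cE; lra.
have := PQ _ tw; rewrite Rintegral_affine//.
have tq : testfun (fun x => c ^+ 2 * (1 + s ^+ 2) + (2 * c ^+ 2 * s) * v x).
  apply: test_affine => // x; have /andP[vx0 vx1] := tv.2 x.
  have h : 0 <= 2 * c ^+ 2 * s by rewrite !mulr_ge0// sqr_ge0.
  have h' : 0 <= c ^+ 2 * (1 + s ^+ 2).
    by rewrite mulr_ge0 ?sqr_ge0// addr_ge0 ?sqr_ge0.
  rewrite addr_ge0 ?(mulr_ge0 h)//=.
  apply: (@le_trans _ _ (c ^+ 2 * (1 + s ^+ 2) + (2 * c ^+ 2 * s))).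
    by rewrite lerD2l ler_piMr.
  rewrite le_eqVlt; apply/orP; left; apply/eqP.
  by transitivity ((c * (1 + s)) ^+ 2); [ring|rewrite cE expr1n].
have le1 : \int[Q]_x ((c + c * s * v x) ^+ 2) <=
    c ^+ 2 * (1 + s ^+ 2) + (2 * c ^+ 2 * s) * \int[Q]_x v x.
  rewrite -Rintegral_affine//; apply: (le_Rintegral_test Q (test_sqr tw) tq).
  move=> x; have /andP[vx0 vx1] := tv.2 x.
  have : c ^+ 2 * s ^+ 2 * (v x ^+ 2) <= c ^+ 2 * s ^+ 2 * 1.
    by rewrite ler_wpM2l ?mulr_ge0 ?sqr_ge0// expr_le1.
  nra.
have /andP[+ _] := Rintegral_test Q (test_sqr tw).
move: (\int[P]_x v x) (\int[Q]_x v x) (\int[Q]_x ((c + c * s * v x) ^+ 2)) v0 v1 w0 w1 le1.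
move=> p q y p0 p1 q0 q1 le1 y0 pq.
have : (1 + s * p) ^+ 2 <= (1 + s ^+ 2) * (1 + s ^+ 2 + 2 * s * q).
  have c2 : 0 < c ^+ 2 by rewrite exprn_gt0.
  rewrite -(ler_pM2l c2) -exprMn (_ : c * (1 + s * p) = c + c * s * p); last by ring.
  apply: (le_trans pq); apply: (@le_trans _ _ ((1 + s ^+ 2) * y)).
    by rewrite ler_wpM2r.
  rewrite [leRHS](_ : _ = (1 + s ^+ 2) *
    (c ^+ 2 * (1 + s ^+ 2) + 2 * c ^+ 2 * s * q)); last by ring.
  by rewrite ler_wpM2l// addr_ge0 ?sqr_ge0.
(* (1 + s^2) (1 + s^2 + 2 s q) = (1 + s^2 + s q)^2 - (s q)^2 *)
apply: contraPP => /negP; rewrite -ltNge => pqs; apply/negP; rewrite -ltNge.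
have sq0 : 0 <= s * q by rewrite mulr_ge0.
have lt1 : 1 + s ^+ 2 + s * q < 1 + s * p.
  have : s * (q + s) < s * p by rewrite ltr_pM2l.
  by rewrite mulrDr -expr2; lra.
have m0 : 0 <= 1 + s ^+ 2 + s * q by rewrite !addr_ge0 ?sqr_ge0.
apply: (@le_lt_trans _ _ ((1 + s ^+ 2 + s * q) ^+ 2)).
  rewrite -subr_ge0 (_ : _ - _ = (s * q) ^+ 2) ?sqr_ge0//; ring.
by rewrite ltr_pXn2r// nnegrE// (le_trans m0)// ltW.
Qed.

End iid_tests.

(** * Replacing the law of the records one at a time *)

Section almost_sure.
Context d (T : measurableType d) (R : realType).
Implicit Types (P Q : probability T R) (n : nat) (X : set T).

Lemma le_Rintegral_as P X (f g : T -> R) : measurable X -> P X = 1%E ->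
  P.-integrable setT (EFin \o f) -> P.-integrable setT (EFin \o g) ->
  (forall x, X x -> f x <= g x) -> \int[P]_x f x <= \int[P]_x g x.
Proof.
move=> mX PX fi gi fg.
have P0 : P (~` X) = 0%E by rewrite probability_setC// PX subee.
have toX h : P.-integrable setT (EFin \o h) ->
    \int[P]_x h x = \int[P]_(x in X) h x.
  move=> hi; rewrite /Rintegral (negligible_integral _ _ _ P0)//.
    by rewrite setTD setCK.
  exact: measurableC.
rewrite !toX//; apply: le_Rintegral => //.
- exact: (integrableS _ _ (@subsetT _ X)).
- exact: (integrableS _ _ (@subsetT _ X)).
Qed.

Lemma le_Rintegral_prob1 P X u v c : measurable X -> P X = 1%E ->
  testfun u -> testfun v -> (forall x, X x -> u x <= v x + c) ->
  \int[P]_x u x <= \int[P]_x v x + c.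
Proof.
move=> mX PX tu tv uv.
rewrite -[X in _ + X](Rintegral_prob_cst P c) -RintegralD//; last 2 first.
- exact: test_integrable.
- exact: finite_measure_integrable_cst.
apply: (le_Rintegral_as mX PX) => //; first exact: test_integrable.
have := integrableD measurableT (test_integrable P measurableT tv)
  (finite_measure_integrable_cst P c measurableT).
exact.
Qed.

End almost_sure.

Section hybrid.
Context d (T : measurableType d) (R : realType).
Implicit Types (P Q : probability T R) (n : nat) (X : set T).

Definition all_in X n : set (n.-tuple T) := [set t | forall i, X (tnth t i)].

Lemma measurable_all_in X n : measurable X -> measurable (all_in X (n := n)).
Proof.
move=> mX; rewrite (_ : all_in X (n := n) = \bigcap_(i in [set: 'I_n])
    ((fun t : n.-tuple T => tnth t i) @^-1` X)).
  apply: fin_bigcap_measurable => // i _; rewrite -[X in measurable X]setTI.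
  exact: measurable_tnth.
by apply/seteqP; split => [t At i _|t At i]; [exact: At|exact: (At i I)].
Qed.

Lemma iid_all_in P X n : measurable X -> P X = 1%E ->
  iid P n (all_in X (n := n)) = 1%E.
Proof.
move=> mX PX; rewrite (iid_setX P (A := fun=> X))//.
by rewrite big1.
Qed.

Lemma all_in_cons X n x (t : n.-tuple T) :
  X x -> all_in X t -> all_in X (cons_pair (x, t)).
Proof.
move=> Xx Xt i; case: (unliftP ord0 i) => [j|] ->; last by rewrite tnth0.
by rewrite tnthS; exact: Xt.
Qed.

Definition one_change n (t t' : n.-tuple T) :=
  exists i, forall j, j != i -> tnth t j = tnth t' j.

(** If a function changes by at most [rho] when one coordinate is replaced, then
    freezing all coordinates but one leaves a function of oscillation at most
    [rho]. Hence exchanging P for Q in one coordinate costs [kappa], and n such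
    exchanges lead from the n-fold product of P to that of Q. The oscillation
    is controlled on a set [X] of full measure, because privacy only compares
    data sets whose design points lie in [0, 1]. *)
Lemma hybrid_bound P Q X (kappa rho : R) n (u : n.-tuple T -> R) :
  measurable X -> P X = 1%E -> Q X = 1%E ->
  (forall v, testfun v -> (forall x y, X x -> X y -> v x <= v y + rho) ->
     \int[P]_x v x <= \int[Q]_x v x + kappa) ->
  testfun u ->
  (forall t t', all_in X t -> all_in X t' -> one_change t t' ->
     u t <= u t' + rho) ->
  \int[iid P n]_t u t <= \int[iid Q n]_t u t + n%:R * kappa.
Proof.
move=> mX PX QX PQ; elim: n u => [|n IH] u tu osc.
  by rewrite !Rintegral_iid0// mul0r addr0.
rewrite !Rintegral_iidS//.
pose U x := \int[iid P n]_t u (cons_pair (x, t)).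
pose V x := \int[iid Q n]_t u (cons_pair (x, t)).
have tU : testfun U by exact: test_cons_marginal.
have tV : testfun V by exact: test_cons_marginal.
apply: (@le_trans _ _ (\int[Q]_x U x + kappa)).
  apply: PQ => // x y Xx Xy.
  apply: (@le_Rintegral_prob1 _ _ _ (iid P n) (@all_in X n)
    (fun t => u (cons_pair (x, t))) (fun t => u (cons_pair (y, t)))).
  - exact: measurable_all_in.
  - exact: iid_all_in.
  - exact: test_cons_section.
  - exact: test_cons_section.
  - move=> t Xt; apply: osc; [exact: all_in_cons|exact: all_in_cons|].
    by exists ord0 => j; case: (unliftP ord0 j) => [i|] -> //; rewrite !tnthS.
rewrite -(natr1 n) mulrDl mul1r addrA lerD2r.
apply: (le_Rintegral_prob1 mX QX) => // x Xx; apply: IH.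
  exact: test_cons_section.
move=> t t' Xt Xt' [i ti]; apply: osc; [exact: all_in_cons..|].
exists (lift ord0 i) => j; case: (unliftP ord0 j) => [l|] -> //.
by rewrite (inj_eq lift_inj) !tnthS; exact: ti.
Qed.

End hybrid.

(** * General facts on integrals *)

(** The integral of a nonnegative function is a supremum over the simple
    functions below it, so monotonicity needs no measurability. This is what
    allows one to bound from below the risk, an iterated integral of the loss,
    without showing that the loss is a measurable function of the estimate. *)
Lemma ge0_le_integral_any d (T : measurableType d) (R : realType)
    (mu : {measure set T -> \bar R}) (f g : T -> \bar R) :
  (forall x, 0 <= f x)%E -> (forall x, f x <= g x)%E ->
  (\int[mu]_x f x <= \int[mu]_x g x)%E.
Proof.
move=> f0 fg; have g0 x : (0 <= g x)%E by exact: le_trans (fg x).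
rewrite !ge0_integralTE//; apply: ereal_sup_le => _ [h hf <-].
by exists h => // x; exact: le_trans (hf x) (fg x).
Qed.

Lemma Rintegral_sum d (T : measurableType d) (R : realType)
    (mu : {measure set T -> \bar R}) (D : set T) (I : Type) (s : seq I)
    (h : I -> T -> R) : measurable D ->
  (forall i, mu.-integrable D (EFin \o h i)) ->
  mu.-integrable D (fun x => (\sum_(i <- s) h i x)%:E) /\
  \int[mu]_(x in D) (\sum_(i <- s) h i x) = \sum_(i <- s) \int[mu]_(x in D) h i x.
Proof.
move=> mD hi; elim: s => [|i s [IHi IH]].
  under eq_fun do rewrite big_nil; split; first exact: integrable0.
  by rewrite /Rintegral; under eq_integral do rewrite big_nil;
    rewrite integral0 big_nil.
under eq_fun do rewrite big_cons; split.
  by have := integrableD mD (hi i) IHi; exact.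
rewrite big_cons -IH -RintegralD//.
by apply: eq_Rintegral => x _; rewrite big_cons.
Qed.

Section density.
Local Open Scope ereal_scope.
Context d (T : measurableType d) (R : realType).
Variables (mu nu : {measure set T -> \bar R}) (p : T -> R).
Hypotheses (mp : measurable_fun setT p) (p0 : forall x, (0 <= p x)%R).
Hypothesis nuE : forall A, measurable A -> nu A = \int[mu]_(x in A) (p x)%:E.

Import HBNNSimple.

Lemma ge0_integral_density (f : T -> \bar R) :
  measurable_fun setT f -> (forall x, 0 <= f x) ->
  \int[nu]_x f x = \int[mu]_x (f x * (p x)%:E).
Proof.
move=> mf f0.
have mpE : measurable_fun setT (EFin \o p) by exact/measurable_EFinP.
have simple (h : {nnsfun T >-> R}) :
    \int[nu]_x (h x)%:E = \int[mu]_x ((h x)%:E * (p x)%:E).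
  under eq_integral do rewrite fimfunE -fsumEFin//.
  rewrite ge0_integral_fsum//; last 2 first.
  - by move=> r; exact/measurable_EFinP/measurableT_comp.
  - by move=> r x _; rewrite EFinM nnfun_muleindic_ge0.
  under [RHS]eq_integral.
    move=> x _; rewrite fimfunE -fsumEFin// muleC ge0_mule_fsumr; last first.
      by move=> r; rewrite EFinM nnfun_muleindic_ge0.
    over.
  rewrite [RHS]ge0_integral_fsum//; last 2 first.
  - move=> r; apply: emeasurable_funM => //.
    by apply/measurable_EFinP/measurableT_comp.
  - move=> r x _; apply: mule_ge0; first by rewrite lee_fin.
    by rewrite EFinM nnfun_muleindic_ge0.
  apply: eq_fsbigr => r _; have [r0|r0] := leP 0%R r; last first.
    by rewrite preimage_nnfun0//; under eq_integral do rewrite indic0 mulr0;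
      under [RHS]eq_integral do rewrite indic0 mulr0 mule0; rewrite !integral0.
  under [RHS]eq_integral do rewrite EFinM muleCA.
  rewrite [RHS]ge0_integralZl//; last 2 first.
  - by apply: emeasurable_funM => //; exact/measurable_EFinP.
  - by move=> x _; rewrite mule_ge0 ?lee_fin.
  rewrite integralZl_indic_nnsfun// integral_indic// setIT nuE//; congr (_ * _).
  rewrite [LHS]integral_mkcond; apply: eq_integral => x _.
  by rewrite patchE indicE; case: ifP; rewrite ?mule1 ?mule0.
pose h := nnsfun_approx measurableT mf.
have h_cvg x : (h n x)%:E @[n --> \oo] --> f x.
  by apply: cvg_nnsfun_approx.
have h_nd x : {homo (fun n => (h n x)%:E) : m n / (m <= n)%N >-> m <= n}.
  by move=> m n mn; rewrite lee_fin; exact/lefP/nd_nnsfun_approx.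
transitivity (limn (fun n => \int[nu]_x (h n x)%:E)).
  rewrite -monotone_convergence//.
  - by apply: eq_integral => x _; apply/esym/cvg_lim.
  - by move=> n; exact/measurable_EFinP.
  - by move=> n x _; rewrite lee_fin.
rewrite (_ : (fun n => _) = (fun n => \int[mu]_x ((h n x)%:E * (p x)%:E))).
  rewrite -monotone_convergence//.
  - apply: eq_integral => x _; apply/cvg_lim => //.
    by apply: cvgeZr => //.
  - by move=> n; apply: emeasurable_funM => //; exact/measurable_EFinP.
  - by move=> n x _; rewrite mule_ge0 ?lee_fin.
  - by move=> x _ m n mn; rewrite lee_wpmul2r ?lee_fin//; exact: h_nd.
by apply/funext => n; exact: simple.
Qed.

End density.

(** * The chi-square bound for normal laws *)

Lemma lebesgue_shift (R : realType) (a : R) (f : measurableTypeR R -> \bar R) :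
  measurable_fun setT f -> (forall x, 0 <= f x)%E ->
  (\int[lebesgue_measure]_x f (a + x)%R = \int[lebesgue_measure]_x f x)%E.
Proof.
move=> mf f0.
pose sh : measurableTypeR R -> measurableTypeR R := fun x => a + x.
have ms : measurable_fun setT sh by exact: measurable_funD.
transitivity (\int[pushforward lebesgue_measure sh]_x f x)%E.
  by rewrite ge0_integral_pushforward.
apply: eq_measure_integral => A mA _; apply/esym.
apply: lebesgue_measure_unique => //= _ [[x y]] _ <-.
rewrite /pushforward.
rewrite (_ : sh @^-1` _ = `]x - a, y - a]%classic); last first.
  by apply/seteqP; split=> z /=; rewrite !in_itv/= /sh ltrBlDl lerBrDl.
rewrite !lebesgue_measure_itv/= !lte_fin ltrD2r.
by case: ifP => // _; rewrite -!EFinB; congr EFin; ring.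
Qed.

(** Locked, as otherwise comparing two normal laws with distinct means unfolds
    their constructions as measures. *)
HB.lock Definition gaussian (R : realType) (a sigma : R) :
  probability (measurableTypeR R) R := normal_prob a sigma.

Section normal_translates.
Context (R : realType) (sigma : R).
Hypothesis sigma0 : sigma != 0.
Local Notation N a := (gaussian a sigma).
Local Notation pdf a := (normal_pdf a sigma).

Lemma ge0_integral_normal a (f : measurableTypeR R -> \bar R) :
  measurable_fun setT f -> (forall x, 0 <= f x)%E ->
  (\int[N a]_x f x = \int[lebesgue_measure]_x (f x * (pdf a x)%:E))%E.
Proof.
apply: (@ge0_integral_density _ _ R lebesgue_measure (N a) (pdf a)).
- exact: measurable_normal_pdf.
- by move=> x; exact: normal_pdf_ge0.
- by move=> A _; rewrite gaussian.unlock.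
Qed.

Lemma normal_pdf_shift a x : pdf a (a + x) = pdf 0 x.
Proof.
by rewrite !normal_pdfE// /normal_fun subr0 addrAC subrr add0r.
Qed.

Lemma Rintegral_normal_shift a (u : measurableTypeR R -> R) : testfun u ->
  \int[N 0]_x u (a + x) = \int[N a]_x u x.
Proof.
move=> tu.
have tua : testfun ((fun x => u (a + x)) : measurableTypeR R -> R).
  by apply: test_comp tu; exact: measurable_funD.
apply: EFin_inj; rewrite (test_EFin (N 0) tua) (test_EFin (N a) tu).
rewrite (ge0_integral_normal a (test_emeasurable tu)); last first.
  by move=> x; exact: test_EFin_ge0.
rewrite (ge0_integral_normal 0 (test_emeasurable tua)); last first.
  by move=> x; exact: test_EFin_ge0.
rewrite -[RHS](lebesgue_shift a).
- by apply: eq_integral => x _; rewrite normal_pdf_shift.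
- apply: emeasurable_funM; first exact: test_emeasurable.
  by apply/measurable_EFinP; exact: measurable_normal_pdf.
- by move=> x; rewrite mule_ge0 ?lee_fin ?normal_pdf_ge0//; case/andP: (tu.2 x).
Qed.

(** Completing the square: the density p_a^2 / p_b is a multiple of a third
    normal density, so its integral is the explicit factor. *)
Lemma normal_pdf_sqr a b x : pdf a x ^+ 2 =
  expR ((a - b) ^+ 2 / sigma ^+ 2) * pdf (2 * a - b) x * pdf b x.
Proof.
rewrite !normal_pdfE// /normal_fun exprMn expr2 -!expRM_natl.
rewrite [RHS](_ : _ = normal_peak sigma ^+ 2 *
  (expR ((a - b) ^+ 2 / sigma ^+ 2) *
   expR (- (x - (2 * a - b)) ^+ 2 / (sigma ^+ 2 *+ 2)) *
   expR (- (x - b) ^+ 2 / (sigma ^+ 2 *+ 2)))); last by ring.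
rewrite -!expRD; congr (_ * expR _).
by field.
Qed.

Lemma integrable_test_pdf a (u : measurableTypeR R -> R) : testfun u ->
  lebesgue_measure.-integrable setT (fun x => (u x * pdf a x)%:E).
Proof.
move=> tu; apply: (le_integrable _ _ _ (integrable_normal_pdf a sigma)) => //.
  apply/measurable_EFinP; apply: measurable_funM; first exact: tu.1.
  exact: measurable_normal_pdf.
move=> x _; have /andP[u0 u1] := tu.2 x.
rewrite lee_fin normrM (ger0_norm u0) ler_piMl//.
Qed.

Lemma Rintegral_normal a (u : measurableTypeR R -> R) : testfun u ->
  \int[N a]_x u x = \int[lebesgue_measure]_x (u x * pdf a x).
Proof.
move=> tu; congr fine; rewrite ge0_integral_normal//.
- exact: test_emeasurable.
- by move=> x; exact: test_EFin_ge0.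
Qed.

(** Pointwise, 2 l u p_a <= l^2 p_a^2 / p_b + u^2 p_b; integrate. *)
Lemma chi2_le_normal a b :
  chi2_le (N a) (N b) (expR ((a - b) ^+ 2 / sigma ^+ 2)).
Proof.
move=> u tu; set A := expR _.
have A0 : 0 < A by exact: expR_gt0.
have tu2 := test_sqr tu.
have key l : 2 * l * \int[N a]_x u x <= l ^+ 2 * A + \int[N b]_x (u x ^+ 2).
  have int1 : \int[N (2 * a - b)]_x cst 1 x = 1 :> R.
    exact: (@Rintegral_prob_cst _ _ _ (N (2 * a - b))).
  have t1 : testfun (cst 1 : measurableTypeR R -> R) by 
    by apply: test_cst; rewrite lexx ler01.
  rewrite -[X in _ <= X + _]mulr1 -[X in _ <= _ * X + _]int1.
  rewrite !Rintegral_normal// -!RintegralZl//; last 2 first.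
  - exact: (integrable_test_pdf _ t1).
  - exact: (integrable_test_pdf _ tu).
  have intZ c w v : testfun v -> lebesgue_measure.-integrable setT
      (EFin \o (fun x => c * (v x * pdf w x))).
    move=> tv; have := @integrableZl _ _ _ lebesgue_measure _ measurableT c _
      (integrable_test_pdf w tv).
    exact.
  have int2 : lebesgue_measure.-integrable setT
      (EFin \o (fun x => u x ^+ 2 * pdf b x)).
    exact: (integrable_test_pdf _ tu2).
  rewrite -RintegralD//; last exact: intZ.
  apply: le_Rintegral => //; first exact: intZ.
    have := integrableD measurableT (intZ (l ^+ 2 * A) (2 * a - b) _ t1) int2.
    exact.
  move=> x _; rewrite mul1r.
  have pb0 : 0 < pdf b x.
    by rewrite normal_pdfE// mulr_gt0 ?normal_peak_gt0 ?expR_gt0.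
  (* after multiplication by p_b the difference is (l p_a - u p_b)^2 *)
  rewrite -(ler_pM2r pb0) -subr_ge0.
  have := normal_pdf_sqr a b x; rewrite -/A => pE.
  rewrite [leRHS](_ : _ = (l * pdf a x - u x * pdf b x) ^+ 2) ?sqr_ge0//.
  by rewrite sqrrB exprMn pE; ring.
exact: sqr_le_linear.
Qed.

End normal_translates.

(** * One observation under two nearby regression functions *)

(** Locked for the same reason as [gaussian]. *)
HB.lock Definition design (R : realType) : probability (measurableTypeR R) R :=
  uniform_prob (@ltr01 R).

Definition record_of (R : realType) (f : measurableTypeR R -> R) (z : obs R) : obs R :=
  (f z.1 + z.2, z.1).

Lemma measurable_record_of (R : realType) (f : measurableTypeR R -> R) :
  measurable_fun setT f -> measurable_fun setT (record_of f).
Proof.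
move=> mf; apply: measurable_fun_pair => //.
by apply: measurable_funD => //; exact: measurableT_comp.
Qed.

HB.lock Definition obs_law (R : realType) (sigma : R)
    (f : measurableTypeR R -> R) (mf : measurable_fun setT f) :
    probability (obs R) R :=
  distribution (design_noise sigma)
    (mfun_Sub (mem_set (measurable_record_of mf))).

Lemma Rintegral_obs_law (R : realType) (sigma : R)
    (f : measurableTypeR R -> R) (mf : measurable_fun setT f) (u : obs R -> R) :
  testfun u ->
  \int[obs_law sigma mf]_o u o = \int[design_noise sigma]_z u (record_of f z).
Proof. by move=> tu; rewrite obs_law.unlock Rintegral_distribution. Qed.

Section observations.
Context (R : realType) (sigma : R).
Hypothesis sigma0 : sigma != 0.
Implicit Types f g : measurableTypeR R -> R.
Local Notation U := (design R).

Lemma design_noiseE : design_noise sigma = (U \x gaussian 0 sigma)%E.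
Proof. by rewrite design.unlock gaussian.unlock. Qed.

Lemma designE (A : set (measurableTypeR R)) : measurable A ->
  U A = lebesgue_measure (A `&` itv01).
Proof.
move=> mA; rewrite design.unlock -[in LHS](setIT A).
rewrite -(@integral_indic _ _ _ (uniform_prob (@ltr01 R)) setT)//.
rewrite integral_uniform//; last exact/measurable_EFinP/measurable_indic.
by rewrite subr0 invr1 mul1e integral_indic.
Qed.

Lemma design_itv01 : U itv01 = 1%E.
Proof.
rewrite designE; last exact: measurable_itv.
by rewrite setIid lebesgue_measure_itv/= lte01 sube0.
Qed.

Lemma test_slice f (u : obs R -> R) : measurable_fun setT f -> testfun u ->
  testfun (fun x => \int[gaussian (f x) sigma]_y u (y, x)).
Proof.
move=> mf tu.
rewrite (_ : (fun x => _) = fun x => \int[gaussian 0 sigma]_z u (f x + z, x)).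
  apply: (@test_marginal _ _ _ _ _ _ (fun z => u (record_of f z))).
  exact: test_comp (measurable_record_of mf) tu.
apply/funext => x; rewrite (@Rintegral_normal_shift _ _ sigma0 (f x) (fun y => u (y, x)))//.
by apply: test_comp tu; exact: measurable_fun_pair.
Qed.

Lemma Rintegral_obs f (mf : measurable_fun setT f) (u : obs R -> R) : testfun u ->
  \int[obs_law sigma mf]_o u o = \int[U]_x \int[gaussian (f x) sigma]_y u (y, x).
Proof.
move=> tu; rewrite Rintegral_obs_law// design_noiseE Rintegral_prod; last first.
  exact: test_comp (measurable_record_of mf) tu.
apply: eq_Rintegral => x _.
rewrite (@Rintegral_normal_shift _ _ sigma0 (f x) (fun y => u (y, x)))//.
by apply: test_comp tu; exact: measurable_fun_pair.
Qed.

Lemma Rintegral_indic_le (B : set (measurableTypeR R)) (b : R) :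
  measurable B -> (U B <= b%:E)%E -> \int[U]_x \1_B x <= b.
Proof.
move=> mB Bb; rewrite -lee_fin test_EFin ?integral_indic ?setIT//.
exact: test_indic.
Qed.

Section close_functions.
Variables (f g : measurableTypeR R -> R).
Hypotheses (mf : measurable_fun setT f) (mg : measurable_fun setT g).
Variables (B : set (measurableTypeR R)) (dist beta : R).
Hypotheses (mB : measurable B) (UB : (U B <= beta%:E)%E).
Hypothesis fgB : forall x, `|f x - g x| <= dist * \1_B x.
Let A := expR (dist ^+ 2 / sigma ^+ 2).

Let A1 : 1 <= A.
Proof. by rewrite -expR0 ler_expR divr_ge0 ?sqr_ge0. Qed.

Let chi2_slice x :
  chi2_le (gaussian (f x) sigma) (gaussian (g x) sigma) (1 + (A - 1) * \1_B x).
Proof.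
move=> u tu; apply: (le_trans (chi2_le_normal sigma0 (f x) (g x) tu)).
rewrite ler_wpM2r//.
  by case/andP: (Rintegral_test (gaussian (g x) sigma) (test_sqr tu)).
have := fgB x; rewrite indicE; case: (x \in B) => /=; rewrite ?mulr1 ?mulr0.
  have -> : 1 + (A - 1) = A by ring.
  move=> fgd; rewrite ler_expR ler_wpM2r ?invr_ge0 ?sqr_ge0//.
  by rewrite -real_normK ?num_real// ler_sqr ?nnegrE// (le_trans _ fgd).
by rewrite normr_le0 => /eqP ->; rewrite expr0n/= mul0r expR0 addr0.
Qed.

(** Conditionally on the design point x the bound is A if x is in B and 1 if
    not; its linearised form averages over x. *)
Lemma chi2_le_obs :
  chi2_le (obs_law sigma mf) (obs_law sigma mg) (1 + (A - 1) * beta).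
Proof.
move=> u tu; have tu2 := test_sqr tu.
rewrite !Rintegral_obs//.
have tp := test_slice mf tu; have tq := test_slice mg tu2.
have tB := test_indic R mB.
have beta0 : 0 <= beta by rewrite -lee_fin (le_trans _ UB).
apply: sqr_le_linear => [|l]; first by rewrite ltr_wpDr// mulr_ge0// subr_ge0.
apply: (@le_trans _ _ (l ^+ 2 + (l ^+ 2 * (A - 1)) * \int[U]_x \1_B x +
    \int[U]_x \int[gaussian (g x) sigma]_y (u (y, x) ^+ 2))); last first.
  rewrite lerD2r [leRHS]mulrDr mulr1 lerD2l mulrA ler_wpM2l//.
    by rewrite mulr_ge0 ?sqr_ge0// subr_ge0.
  exact: Rintegral_indic_le.
rewrite -Rintegral_affine// -RintegralD//; last 2 first.
- exact: integrable_affine.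
- exact: test_integrable.
rewrite -RintegralZl//; last exact: test_integrable.
apply: le_Rintegral => //.
- by under eq_fun do rewrite -[_ * _]add0r; exact: integrable_affine.
- have := integrableD measurableT (integrable_affine U (l ^+ 2) (l ^+ 2 * (A - 1)) tB)
    (test_integrable U measurableT tq).
  exact.
move=> x _; have tux : testfun (fun y => u (y, x)).
  by apply: test_comp tu; exact: measurable_fun_pair.
rewrite (_ : l ^+ 2 + _ = l ^+ 2 * (1 + (A - 1) * \1_B x)); last by ring.
apply: linear_le_sqr (chi2_slice x tux).
by rewrite ltr_wpDr// mulr_ge0 ?subr_ge0// indicE.
Qed.

(** A function of oscillation [rho] becomes a test function after rescaling, so
    that on the slices over B the means differ by at most 2 [rho] times the
    bound [s] on the total variation distance of the two normal laws. *)
Lemma le_obs_slices (v : obs R -> R) (rho s : R) : testfun v ->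
  0 < rho -> 0 < s -> A <= 1 + s ^+ 2 ->
  (forall x y, itv01 x.2 -> itv01 y.2 -> v x <= v y + rho) ->
  \int[obs_law sigma mf]_o v o <= \int[obs_law sigma mg]_o v o + 2 * rho * s * beta.
Proof.
move=> tv rho0 s0 As osc; rewrite !Rintegral_obs//.
have tp := test_slice mf tv; have tq := test_slice mg tv.
have tB := test_indic R mB.
have c0 : 0 <= 2 * rho * s by rewrite !mulr_ge0// ltW.
apply: (@le_trans _ _ (0 + 2 * rho * s * \int[U]_x \1_B x +
    \int[U]_x \int[gaussian (g x) sigma]_y v (y, x))); last first.
  by rewrite add0r addrC lerD2l ler_wpM2l// Rintegral_indic_le.
rewrite -Rintegral_affine// -RintegralD//; last 2 first.
- exact: integrable_affine.
- exact: test_integrable.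
have m01 : measurable (itv01 : set (measurableTypeR R)) by exact: measurable_itv.
apply: (le_Rintegral_as m01 design_itv01).
- exact: test_integrable.
- have := integrableD measurableT (integrable_affine U 0 (2 * rho * s) tB)
    (test_integrable U measurableT tq).
  exact.
move=> x x01; rewrite add0r addrC.
have tvx : testfun (fun y => v (y, x)).
  by apply: test_comp tv; exact: measurable_fun_pair.
have r2 : 0 < 2 * rho by rewrite mulr_gt0.
(* v takes values within rho of v (0, x) on this slice; w maps that range into [0, 1] *)
pose w y := (rho - v (0, x)) / (2 * rho) + (2 * rho)^-1 * v (y, x).
have tw : testfun w.
  apply: test_affine => // y.
  have h1 : v (y, x) <= v (0, x) + rho by exact: osc.
  have h2 : v (0, x) <= v (y, x) + rho by exact: osc.
  rewrite mulrC -mulrDr mulr_ge0 ?invr_ge0 ?(ltW r2)//=; last by lra.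
  by rewrite mulrC ler_pdivrMr//; lra.
have [xB|xB] := boolP (x \in B); last first.
  have := fgB x; rewrite indicE (negbTE xB) mulr0 normr_le0 subr_eq0 => /eqP ->.
  by rewrite mulr0 addr0.
have As' : 1 + (A - 1) * \1_B x <= 1 + s ^+ 2.
  by rewrite indicE xB mulr1 (_ : 1 + (A - 1) = A)//; ring.
have := chi2_le_TV s0 As' (chi2_slice x) tw.
rewrite !Rintegral_affine// indicE xB mulr1 -addrA lerD2l.
rewrite -(ler_pM2l r2) mulrDr !mulVKf ?gt_eqF//.
Qed.

End close_functions.

End observations.

(** * Pairings on L^2 are Borel *)

Section L2_pairing.
Context (R : realType).
Local Notation mu := (lebesgue_measure : {measure set (measurableTypeR R) -> \bar R}).
Implicit Types (g h : L2_class R) (psi : measurableTypeR R -> R).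

Lemma measurable_itv01 : measurable (itv01 : set (measurableTypeR R)).
Proof. exact: measurable_itv. Qed.

Lemma lebesgue_itv01 : mu itv01 = 1%E.
Proof. by rewrite [LHS](@lebesgue_measure_itv R `[0, 1])/= lte01 sube0. Qed.

Lemma bounded_integrable01 psi M : measurable_fun setT psi ->
  (forall x, `|psi x| <= M) -> mu.-integrable itv01 (EFin \o psi).
Proof.
move=> mpsi psiM; apply: measurable_bounded_integrable.
- exact: measurable_itv01.
- by rewrite lebesgue_itv01 ltry.
- exact: measurable_funTS.
- exists M; split; [exact: num_real|move=> N MN x _].
  by apply: (le_trans (psiM x)); exact: ltW.
Qed.

Lemma L2_measurable g : measurable_fun setT (g : measurableTypeR R -> R).
Proof. exact: (measurable_funPT (repr (g : {mfun_ (leb01 R), _ >-> _}))). Qed.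

Lemma L2_sqr_integrable g : mu.-integrable itv01 (fun x => (g x ^+ 2)%:E).
Proof.
have gL : (g : measurableTypeR R -> R) \in Lfun (leb01 R) 2%:E.
  rewrite inE; apply/andP; split; rewrite inE/=; first exact: L2_measurable.
  exact: Lebesgue_finite.
have /integrableP[mg2 g2] := Lfun2_integrable_sqr gL.
apply/integrableP; split; first exact: measurable_funTS.
rewrite (eq_measure_integral (leb01 R)) => [|A _ A01].
  apply: le_lt_trans g2; apply: ge0_subset_integral => //.
    exact: measurable_itv01.
  exact: measurableT_comp.
by rewrite /leb01/= /mrestr setIidl.
Qed.

Definition pairing psi g := \int[mu]_(x in itv01) (g x * psi x).

Lemma pairing_integrable psi g : measurable_fun setT psi ->
  (forall x, `|psi x| <= 1) -> mu.-integrable itv01 (fun x => (g x * psi x)%:E).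
Proof.
move=> mpsi psi1.
have int1 : mu.-integrable itv01 (EFin \o cst 1).
  by apply: (@bounded_integrable01 _ 1) => // x; rewrite normr1.
apply: (le_integrable measurable_itv01 _ _
    (integrableD measurable_itv01 (L2_sqr_integrable g) int1)).
  apply/measurable_EFinP/measurable_funTS/measurable_funM => //.
  exact: L2_measurable.
move=> x _; rewrite /= lee_fin normrM.
rewrite [leRHS]ger0_norm ?addr_ge0 ?sqr_ge0//.
apply: (@le_trans _ _ `|g x|); first by rewrite ler_piMr.
rewrite -(real_normK (num_real (g x))).
by have := sqr_ge0 (`|g x| - 1); have := sqr_ge0 `|g x|; rewrite sqrrB; lra.
Qed.

Lemma ise_fin_integrable (g f : measurableTypeR R -> R) :
  measurable_fun setT g -> measurable_fun setT f -> (ise g f < +oo)%E ->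
  mu.-integrable itv01 (fun x => ((g x - f x) ^+ 2)%:E).
Proof.
move=> mg mf isefin; apply/integrableP; split.
  apply/measurable_EFinP/measurable_funTS.
  by apply: measurable_funX; exact: measurable_funB.
under eq_integral do rewrite gee0_abs ?lee_fin ?sqr_ge0//.
exact: isefin.
Qed.

(** If the pairing of g is t > 0, it stays positive on the ball of radius t,
    because psi (h - g) >= - (t / 2 + (h - g)^2 / (2 t)). *)
Lemma L2_open_pairing_gt0 psi : measurable_fun setT psi ->
  (forall x, `|psi x| <= 1) -> L2_open [set g | 0 < pairing psi g].
Proof.
move=> mpsi psi1 g /= t0; set t := pairing psi g in t0.
exists t => // h hg.
have hgint := ise_fin_integrable (L2_measurable h) (L2_measurable g)
  (lt_trans hg (ltry _)).
have hgt : \int[mu]_(x in itv01) ((h x - g x) ^+ 2) < t ^+ 2.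
  have fin := integrable_fin_num measurable_itv01 hgint.
  by rewrite -lte_fin /Rintegral fineK.
have intc : mu.-integrable itv01 (EFin \o cst (t / 2)).
  by apply: (@bounded_integrable01 _ `|t / 2|).
have int2 : mu.-integrable itv01
    (EFin \o (fun x => (2 * t)^-1 * (h x - g x) ^+ 2)).
  by have := @integrableZl _ _ _ mu _ measurable_itv01 (2 * t)^-1 _ hgint; exact.
have int3 : mu.-integrable itv01
    (EFin \o (fun x => t / 2 + (2 * t)^-1 * (h x - g x) ^+ 2)).
  by have := integrableD measurable_itv01 intc int2; exact.
have gpint := pairing_integrable g mpsi psi1.
have le1 : t - (t / 2 + (2 * t)^-1 * \int[mu]_(x in itv01) ((h x - g x) ^+ 2))
    <= pairing psi h.
  rewrite -RintegralZl//; last exact: measurable_itv01.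
  have -> : t / 2 = \int[mu]_(x in itv01) cst (t / 2) x.
    rewrite Rintegral_cst; last exact: measurable_itv01.
    by rewrite lebesgue_itv01 mulr1.
  rewrite -RintegralD//; last exact: measurable_itv01.
  rewrite -RintegralB//; last exact: measurable_itv01.
  apply: le_Rintegral.
  - exact: measurable_itv01.
  - by have := integrableB measurable_itv01 gpint int3; exact.
  - exact: pairing_integrable.
  move=> x _; have xp := psi1 x; rewrite /cst.
  have -> : h x * psi x = g x * psi x + (h x - g x) * psi x by ring.
  rewrite lerD2l; set y := h x - g x.
  have yp : - `|y| <= y * psi x.
    rewrite lerNl (le_trans (ler_norm _))// normrN normrM ler_piMr//.
  apply: le_trans yp; rewrite lerN2 -(real_normK (num_real y)).
  rewrite -(ler_pM2l (_ : 0 < 2 * t)) ?mulr_gt0// mulrDr mulVKf ?gt_eqF ?mulr_gt0//.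
  by have := sqr_ge0 (t - `|y|); rewrite sqrrB; lra.
apply: lt_le_trans le1; rewrite subr_gt0.
rewrite -(ltr_pM2l (_ : 0 < 2 * t)) ?mulr_gt0// mulrDr mulVKf ?gt_eqF ?mulr_gt0//.
by lra.
Qed.

Lemma measurable_pairing_le0 psi : measurable_fun setT psi ->
  (forall x, `|psi x| <= 1) -> measurable ([set g | pairing psi g <= 0] : set (L2 R)).
Proof.
move=> mpsi psi1; rewrite (_ : mkset _ = ~` [set g | 0 < pairing psi g]).
  apply: measurableC; apply: sub_sigma_algebra.
  exact: L2_open_pairing_gt0.
by apply/seteqP; split => g /=; rewrite leNgt => /negP.
Qed.

End L2_pairing.

(** * Randomised algorithms and samples *)

Section probability_kernels.
Context d d' (X : measurableType d) (Y : measurableType d') (R : realType).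
Variable M : R.-pker X ~> Y.

Lemma kernel_fin_num x (S : set Y) : measurable S -> M x S \is a fin_num.
Proof.
move=> mS; rewrite ge0_fin_numE// (@le_lt_trans _ _ 1%E) ?ltry//.
by rewrite -(prob_kernel (s := M) x) le_measure// inE.
Qed.

Lemma test_kernel (S : set Y) : measurable S -> testfun (fun x => fine (M x S)).
Proof.
move=> mS; split.
  by apply: measurableT_comp; [exact: fine_measurable|exact: measurable_kernel].
move=> x; rewrite fine_ge0//= -lee_fin fineK ?kernel_fin_num//.
by rewrite -(prob_kernel (s := M) x) le_measure// inE.
Qed.

Lemma fine_kernel_setC x (S : set Y) : measurable S ->
  fine (M x (~` S)) = 1 - fine (M x S).
Proof.
move=> mS; have MT : M x setT = 1%E := prob_kernel (s := M) x.
rewrite -setTD measureD//; last by rewrite [ltLHS]MT ltry.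
by rewrite setTI [X in (X - _)%E]MT fineB// kernel_fin_num.
Qed.

End probability_kernels.

Section sampling.
Context (R : realType) (sigma : R).

Lemma measurable_sample n (f : measurableTypeR R -> R) :
  measurable_fun setT f -> measurable_fun setT (@sample R n f).
Proof.
move=> mf; apply/measurable_fun_tnthP => i.
rewrite (_ : _ \o _ = record_of f \o (@tnth n (obs R) ^~ i)); last first.
  by apply/funext => w /=; rewrite tnth_map.
by apply: measurableT_comp; [exact: measurable_record_of|exact: measurable_tnth].
Qed.

Lemma Rintegral_sample n (f : measurableTypeR R -> R)
    (mf : measurable_fun setT f) (u : n.-tuple (obs R) -> R) : testfun u ->
  \int[iid (design_noise sigma) n]_w u (sample f w) =
  \int[iid (obs_law sigma mf) n]_t u t.
Proof.
elim: n u => [|n IH] u tu.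
  rewrite !Rintegral_iid0//; last exact: test_comp (measurable_sample mf) tu.
  by congr u; exact/val_inj.
have tus := test_comp (measurable_sample mf) tu.
rewrite (Rintegral_iidS (obs_law sigma mf) tu).
rewrite (Rintegral_iidS (design_noise sigma) tus).
rewrite Rintegral_obs_law; last exact: test_cons_marginal.
apply: eq_Rintegral => z _; rewrite -IH; last exact: test_cons_section.
by apply: eq_Rintegral => w _; congr u; exact/val_inj.
Qed.

End sampling.

(** * Assouad's lemma for sums of disjoint bumps *)

Section assouad_combinatorics.
Context (R : realType) (k : nat).
Implicit Types (th : {ffun 'I_k -> bool}).

Definition flip (j : 'I_k) th : {ffun 'I_k -> bool} :=
  [ffun i => if i == j then ~~ th i else th i].

Lemma flipK j : involutive (flip j).
Proof.
by move=> th; apply/ffunP => i; rewrite !ffunE; case: eqP => // _; rewrite negbK.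
Qed.

(** Average over the cube: for each j, pair th with its j-th neighbour. *)
Lemma assouad_average (F : 'I_k -> {ffun 'I_k -> bool} -> R) (c : R) :
  (forall j th, c <= F j th + F j (flip j th)) ->
  exists th, k%:R * (c / 2) <= \sum_j F j th.
Proof.
move=> Fc; apply/not_existsP => small.
have : \sum_th \sum_j F j th < \sum_(th : {ffun 'I_k -> bool}) k%:R * (c / 2).
  have th0 : {ffun 'I_k -> bool} := [ffun=> true].
  rewrite (bigD1 th0)//= [ltRHS](bigD1 th0)//=; apply: ltr_leD.
    by rewrite ltNge; apply/negP/small.
  by apply: ler_sum => th _; rewrite leNgt; apply/negP => /ltW/small.
apply/negP; rewrite -leNgt exchange_big/=.
rewrite (_ : \sum_th _ = \sum_(j < k) \sum_(th : {ffun 'I_k -> bool}) c / 2).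
  apply: ler_sum => j _; rewrite -(ler_pM2l (_ : 0 < 2))// !mulr_sumr.
  apply: (@le_trans _ _ (\sum_th (F j th + F j (flip j th)))).
    by apply: ler_sum => th _; rewrite mulrC divfK.
  rewrite big_split/= [X in _ + X <= _](_ : _ = \sum_th F j th).
    by rewrite -mulr_sumr; lra.
  by rewrite [RHS](reindex_inj (can_inj (flipK j))).
rewrite exchange_big/=; apply: eq_bigr => th _.
by rewrite sumr_const card_ord mulr_natl.
Qed.

End assouad_combinatorics.

Section signed_bumps.
Context (R : realType) (k : nat).
Variable psi : 'I_k -> measurableTypeR R -> R.
Implicit Types (th : {ffun 'I_k -> bool}).

Definition sgnb (b : bool) : R := if b then 1 else -1.

Definition signed_sum th (x : measurableTypeR R) : R := \sum_j sgnb (th j) * psi j x.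

(** A zero pairing counts as negative, so that flipping the sign at j
    complements the set. *)
Definition wrong th j : set (L2 R) :=
  [set g | (pairing (psi j) g <= 0) = th j].

Hypothesis mpsi : forall j, measurable_fun setT (psi j).
Hypothesis psi1 : forall j x, `|psi j x| <= 1.
Hypothesis disj : forall i j x, i != j -> psi i x * psi j x = 0.

Lemma measurable_signed_sum th : measurable_fun setT (signed_sum th).
Proof.
by apply: measurable_sum => j; apply: measurable_funM.
Qed.

Lemma measurable_wrong th j : measurable (wrong th j).
Proof.
have mS := measurable_pairing_le0 (mpsi j) (psi1 j).
rewrite /wrong; case: (th j).
  by rewrite (_ : mkset _ = [set g | pairing (psi j) g <= 0]).
rewrite (_ : mkset _ = ~` [set g | pairing (psi j) g <= 0]).
  exact: measurableC.
by apply/seteqP; split => g /=; [move=> -> |move/negP/negbTE].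
Qed.

Lemma wrong_flip th j : wrong (flip j th) j = ~` wrong th j.
Proof.
apply/seteqP; split => g; rewrite /wrong/= ffunE eqxx.
  by move=> ->; case: (th j).
by case: (_ <= _); case: (th j) => // /(_ erefl).
Qed.

Lemma bumps_orthogonal (c e : 'I_k -> R) x :
  (\sum_j c j * psi j x) * (\sum_j e j * psi j x) =
  \sum_j c j * e j * psi j x ^+ 2.
Proof.
rewrite mulr_suml; apply: eq_bigr => j _.
rewrite mulr_sumr (bigD1 j)//= big1 ?addr0 => [|i ij]; first by ring.
by rewrite mulrACA (disj x) ?mulr0// eq_sym.
Qed.

(** Let t be the sum of the signed bumps at the indices j where g is wrong.
    From (g - f + t)^2 >= 0 and f t = t^2 we get (g - f)^2 >= t^2 - 2 g t, whose
    integral is the sum over these j of the integral of psi_j^2 minus twice the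
    signed pairing, and the latter is at most 0. *)
Lemma ise_signed_sum (r : R) th (g : L2_class R) :
  (forall j, r <= \int[lebesgue_measure]_(x in itv01) psi j x ^+ 2) ->
  ((r * \sum_j \1_(wrong th j) g)%:E <= ise g (signed_sum th))%E.
Proof.
move=> psir.
have [isefin|] := ltP (ise g (signed_sum th)) +oo%E; last first.
  by rewrite leye_eq => /eqP ->; rewrite leey.
have iint := ise_fin_integrable (L2_measurable g) (measurable_signed_sum th) isefin.
pose w j : R := \1_(wrong th j) g.
pose h j x : R := w j * (psi j x ^+ 2 - 2 * sgnb (th j) * (g x * psi j x)).
have gpint j := pairing_integrable g (mpsi j) (psi1 j).
have p2int j : lebesgue_measure.-integrable itv01 (EFin \o (fun x => psi j x ^+ 2)).
  apply: (@bounded_integrable01 _ _ 1).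
    exact: measurable_funX.
  by move=> x; rewrite normrX expr_le1.
have m01 : measurable (itv01 : set (measurableTypeR R)) by exact: measurable_itv01.
have sgint j : lebesgue_measure.-integrable itv01
    (EFin \o (fun x => 2 * sgnb (th j) * (g x * psi j x))).
  by have := @integrableZl _ _ _ _ _ m01 (2 * sgnb (th j)) _ (gpint j); exact.
have dint j : lebesgue_measure.-integrable itv01
    (EFin \o (fun x => psi j x ^+ 2 - 2 * sgnb (th j) * (g x * psi j x))).
  by have := integrableB m01 (p2int j) (sgint j); exact.
have hint j : lebesgue_measure.-integrable itv01 (EFin \o h j).
  by have := @integrableZl _ _ _ _ _ m01 (w j) _ (dint j); exact.
have [sint sE] := Rintegral_sum (index_enum 'I_k) m01 hint.
have -> : ise g (signed_sum th) = (\int[lebesgue_measure]_(x in itv01)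
    ((g x - signed_sum th x) ^+ 2))%:E.
  by rewrite /Rintegral fineK//; exact: integrable_fin_num.
rewrite lee_fin; apply: (@le_trans _ _
  (\int[lebesgue_measure]_(x in itv01) \sum_j h j x)); last first.
  apply: le_Rintegral => // x _.
  rewrite -subr_ge0; set f := signed_sum th x.
  pose t := \sum_j (w j * sgnb (th j)) * psi j x.
  have ft : f * t = \sum_j w j * psi j x ^+ 2.
    rewrite /f /signed_sum /t bumps_orthogonal; apply: eq_bigr => j _.
    by rewrite /sgnb; case: (th j); ring.
  have tt : t * t = \sum_j w j * psi j x ^+ 2.
    rewrite /t bumps_orthogonal; apply: eq_bigr => j _.
    by rewrite /w indicE /sgnb; case: (th j); case: (_ \in _) => /=; ring.
  have -> : \sum_j h j x = f * t - 2 * (g x * t).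
    rewrite ft /t !mulr_sumr -sumrB; apply: eq_bigr => j _.
    by rewrite /h; ring.
  have -> : (g x - f) ^+ 2 - (f * t - 2 * (g x * t)) =
      (g x - f + t) ^+ 2 + (f * t - t * t) by ring.
  by rewrite ft tt subrr addr0 sqr_ge0.
rewrite sE mulr_sumr; apply: ler_sum => j _.
rewrite RintegralZl// RintegralB// RintegralZl// -/(pairing (psi j) g).
rewrite mulrC /w indicE; case: (boolP (g \in wrong th j)) => [|_]; last by rewrite !mul0r.
rewrite inE /wrong/= !mul1r => gth.
apply: (le_trans (psir j)); rewrite lerDl -mulNr.
by move: gth; rewrite /sgnb; case: (th j) => [h1|/negbT]; [|rewrite -ltNge]; nra.
exact: gpint.
Qed.

Lemma wrong_mass_le_risk (r sigma : R) n
    (M : R.-pker (n.-tuple (obs R)) ~> (L2 R)) th : 0 <= r ->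
  (forall j, r <= \int[lebesgue_measure]_(x in itv01) psi j x ^+ 2) ->
  ((r * \sum_j \int[iid (obs_law sigma (measurable_signed_sum th)) n]_t
       fine (M t (wrong th j)))%:E <= risk sigma M (signed_sum th))%E.
Proof.
move=> r0 psir; pose mS := measurable_signed_sum th.
have tK j := test_kernel M (measurable_wrong th j).
pose v w := r * \sum_j fine (M (sample (signed_sum th) w) (wrong th j)).
apply: (@le_trans _ _ (\int[iid (design_noise sigma) n]_w (v w)%:E)%E).
  rewrite le_eqVlt; apply/orP; left; apply/eqP; rewrite /v.
  have tsj j := test_comp (measurable_sample mS) (tK j).
  have isj j := test_integrable (iid (design_noise sigma) n) measurableT (tsj j).
  have [si sE] := Rintegral_sum (index_enum 'I_k) measurableT isj.
  under [RHS]eq_integral do rewrite EFinM.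
  rewrite integralZl// EFinM; congr (_ * _)%E.
  rewrite [in LHS](_ : \sum_j _ = \sum_j \int[iid (design_noise sigma) n]_w
    fine (M (sample (signed_sum th) w) (wrong th j))); last first.
    apply: eq_bigr => j _; exact: (esym (Rintegral_sample sigma mS (tK j))).
  by rewrite -sE /Rintegral fineK//; exact: integrable_fin_num.
apply: ge0_le_integral_any => [w|w].
  rewrite lee_fin /v mulr_ge0//; apply: sumr_ge0 => j _.
  by case/andP: ((tK j).2 (sample (signed_sum th) w)).
set D := sample _ w.
apply: (@le_trans _ _ (\int[M D]_g (r * \sum_j \1_(wrong th j) g)%:E)%E); last first.
  apply: ge0_le_integral_any => g; last exact: ise_signed_sum.
  by rewrite lee_fin mulr_ge0//; apply: sumr_ge0 => j _; rewrite indicE.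
rewrite le_eqVlt; apply/orP; left; apply/eqP; rewrite /v EFinM.
under [RHS]eq_integral do rewrite EFinM -sumEFin.
rewrite ge0_integralZl//; last 2 first.
- apply: emeasurable_sum => j; apply/measurable_EFinP.
  by apply: measurable_indic; exact: measurable_wrong.
- by move=> g _; apply: sume_ge0 => j _; rewrite lee_fin indicE.
congr (_ * _)%E; rewrite ge0_integral_sum//; last first.
  move=> j; apply/measurable_EFinP.
  by apply: measurable_indic; exact: measurable_wrong.
rewrite -sumEFin; apply: eq_bigr => j _.
rewrite integral_indic// ?setIT; last exact: measurable_wrong.
by rewrite fineK// kernel_fin_num//; exact: measurable_wrong.
Qed.

End signed_bumps.

(** * A flipped sign is not detected *)

Section two_points.
Context (R : realType) (sigma : R) (sigma0 : sigma != 0).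

(** The records that privacy applies to. *)
Definition in_design : set (obs R) := [set o | itv01 o.2].

Lemma measurable_in_design : measurable in_design.
Proof.
rewrite (_ : in_design = setT `*` itv01); last first.
  by apply/seteqP; split => o //= [].
by apply: measurableX => //; exact: measurable_itv01.
Qed.

Lemma obs_law_in_design (f : measurableTypeR R -> R) (mf : measurable_fun setT f) :
  obs_law sigma mf in_design = 1%E.
Proof.
rewrite obs_law.unlock design_noiseE /distribution/= /pushforward/=.
rewrite (_ : _ @^-1` _ = itv01 `*` setT); last first.
  by apply/seteqP; split => o //= [].
rewrite product_measure1E//; last exact: measurable_itv01.
by rewrite [X in (X * _)%E](design_itv01 R) [X in (_ * X)%E]probability_setT mule1.
Qed.

Variables (f g : measurableTypeR R -> R).
Hypotheses (mf : measurable_fun setT f) (mg : measurable_fun setT g).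
Variables (B : set (measurableTypeR R)) (dist beta : R).
Hypotheses (mB : measurable B) (UB : (design R B <= beta%:E)%E).
Hypothesis fgB : forall x, `|f x - g x| <= dist * \1_B x.
Variable s : R.
Hypotheses (s0 : 0 < s) (As : expR (dist ^+ 2 / sigma ^+ 2) <= 1 + s ^+ 2).

(** A probability p with p <= e^eps q + delta exceeds q by at most
    e^eps - 1 + delta <= 4 eps, which is the oscillation of the test. *)
Lemma two_points_private n (eps delta : R)
    (M : R.-pker (n.-tuple (obs R)) ~> (L2 R)) (S : set (L2 R)) :
  0 < eps < 1 -> delta <= eps -> n%:R * (8 * eps * s * beta) <= 1 / 2 ->
  diff_private eps delta M -> measurable S ->
  \int[iid (obs_law sigma mf) n]_t fine (M t S) <=
  \int[iid (obs_law sigma mg) n]_t fine (M t S) + 1 / 2.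
Proof.
move=> /andP[eps0 eps1] de small dp mS.
have tu := test_kernel M mS.
have Mfin D : M D S \is a fin_num by exact: kernel_fin_num.
have osc t t' : all_in in_design t -> all_in in_design t' -> one_change t t' ->
    fine (M t S) <= fine (M t' S) + 4 * eps.
  move=> Dt Dt' tt'; have := dp t t' Dt Dt' tt' S mS.
  rewrite -(fineK (Mfin t)) -(fineK (Mfin t')) -EFinM -EFinD lee_fin => h.
  have /andP[u0 u1] := tu.2 t'.
  have /expR_le_1D3x e3 : 0 <= eps <= 1 by lra.
  apply: (le_trans h); nra.
apply: (le_trans (hybrid_bound (kappa := 2 * (4 * eps) * s * beta) measurable_in_design
  (obs_law_in_design mf) (obs_law_in_design mg) _ tu osc)); last first.
  by rewrite lerD2l (_ : 2 * _ * s * beta = 8 * eps * s * beta)//; ring.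
move=> v tv vosc; apply: (le_obs_slices sigma0 mf mg mB UB fgB tv _ s0 As) => //.
by rewrite mulr_gt0.
Qed.

(** With p, q the two means, the chi-square bound on the n-fold products gives
    p^2 <= 2 q, whence p - q <= p - p^2 / 2 <= 1 / 2. *)
Lemma two_points_chi2 n (u : n.-tuple (obs R) -> R) :
  0 <= beta -> n%:R * (s ^+ 2 * beta) <= 1 / 2 -> testfun u ->
  \int[iid (obs_law sigma mf) n]_t u t <=
  \int[iid (obs_law sigma mg) n]_t u t + 1 / 2.
Proof.
move=> beta0 small tu.
have A1 : 1 <= expR (dist ^+ 2 / sigma ^+ 2).
  by rewrite -expR0 ler_expR divr_ge0 ?sqr_ge0.
set A := 1 + (expR (dist ^+ 2 / sigma ^+ 2) - 1) * beta.
have A0 : 0 <= A by rewrite addr_ge0// mulr_ge0// subr_ge0.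
have An : A ^+ n <= 2.
  apply: (@le_trans _ _ (expR (s ^+ 2 * beta) ^+ n)).
    rewrite lerXn2r// ?nnegrE ?expR_ge0//; apply: le_trans (expR_ge1Dx _).
    by rewrite lerD2l ler_wpM2r// lerBlDl.
  rewrite -expRM_natl; apply: (@le_trans _ _ (1 + 2 * (n%:R * (s ^+ 2 * beta)))).
    by apply: expR_le_1D2x; rewrite small mulr_ge0// mulr_ge0// sqr_ge0.
  by lra.
have := chi2_le_iid (n := n) A0 (chi2_le_obs sigma0 mf mg mB UB fgB) tu.
have /andP[p0 p1] := Rintegral_test (iid (obs_law sigma mf) n) tu.
have /andP[q0 q1] := Rintegral_test (iid (obs_law sigma mg) n) tu.
have /andP[r0 _] := Rintegral_test (iid (obs_law sigma mg) n) (test_sqr tu).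
have : \int[iid (obs_law sigma mg) n]_t (u t ^+ 2) <=
    \int[iid (obs_law sigma mg) n]_t u t.
  apply: le_Rintegral_test => //; first exact: test_sqr.
  by move=> t; have /andP[u0 u1] := tu.2 t; rewrite expr2 ler_piMl.
move: (\int[iid (obs_law sigma mg) n]_t (u t ^+ 2)) r0 => r r0 rq pr.
have : A ^+ n * r <= 2 * r by rewrite ler_wpM2r.
nra.
Qed.

End two_points.

Section assouad.
Context (R : realType) (k : nat).
Variable psi : 'I_k -> measurableTypeR R -> R.
Hypothesis mpsi : forall j, measurable_fun setT (psi j).
Hypothesis psi1 : forall j x, `|psi j x| <= 1.
Hypothesis disj : forall i j x, i != j -> psi i x * psi j x = 0.

Lemma assouad_risk (r sigma : R) n
    (M : R.-pker (n.-tuple (obs R)) ~> (L2 R)) : 0 <= r ->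
  (forall j, r <= \int[lebesgue_measure]_(x in itv01) psi j x ^+ 2) ->
  (forall th j S, measurable S ->
    \int[iid (obs_law sigma (measurable_signed_sum mpsi th)) n]_t fine (M t S) <=
    \int[iid (obs_law sigma (measurable_signed_sum mpsi (flip j th))) n]_t
      fine (M t S) + 1 / 2) ->
  exists th, ((r * (k%:R / 4))%:E <= risk sigma M (signed_sum psi th))%E.
Proof.
move=> r0 psir close.
pose F j th := \int[iid (obs_law sigma (measurable_signed_sum mpsi th)) n]_t
  fine (M t (wrong psi th j)).
have Fc j th : 1 / 2 <= F j th + F j (flip j th).
  have mw := measurable_wrong mpsi psi1 th j.
  have -> : F j (flip j th) = 1 + -1 *
      \int[iid (obs_law sigma (measurable_signed_sum mpsi (flip j th))) n]_t
        fine (M t (wrong psi th j)).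
    rewrite -Rintegral_affine; last exact: test_kernel.
    apply: eq_Rintegral => t _; rewrite wrong_flip.
    by rewrite fine_kernel_setC// mulN1r.
  have := close (flip j th) j _ mw; rewrite flipK.
  rewrite -/(F j th). lra.
have [th thF] := assouad_average Fc.
exists th; apply: le_trans (wrong_mass_le_risk mpsi psi1 disj sigma M th r0 psir).
rewrite lee_fin ler_wpM2l//; apply: le_trans thF.
by rewrite le_eqVlt; apply/orP; left; apply/eqP; lra.
Qed.

End assouad.

(** * The bumps and their derivatives *)

Section weak_derivatives.
Context (R : realType).
Local Notation mu := (@lebesgue_measure R).

Lemma weak_deriv_sum (I : Type) (s : seq I) (c : I -> R) (F G : I -> R -> R) :
  (forall i, weak_deriv (F i) (G i)) ->
  weak_deriv (fun x => \sum_(i <- s) c i * F i x)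
             (fun x => \sum_(i <- s) c i * G i x).
Proof.
move=> FG; pose h i x := c i * G i x.
have hint i : (mu : {measure set (measurableTypeR R) -> \bar R}).-integrable
    itv01 (EFin \o h i).
  by have := @integrableZl _ _ _ _ _ (@measurable_itv01 R) (c i) _ (FG i).1; exact.
split=> [|x x01]; first by case: (Rintegral_sum s (@measurable_itv01 R) hint).
have sub : `[0, x]%classic `<=` (itv01 : set R).
  move=> y; rewrite /itv01/= !in_itv/= => /andP[-> /le_trans]; apply.
  by move: x01; rewrite /itv01/= in_itv/= => /andP[].
have m0x : measurable (`[0, x]%classic : set (measurableTypeR R)) by exact: measurable_itv.
have hint' i := integrableS (@measurable_itv01 R) m0x sub (hint i).
have [_ ->] := Rintegral_sum s m0x hint'.
rewrite -big_split/=; apply: eq_bigr => i _.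
rewrite ((FG i).2 x x01) mulrDr RintegralZl//.
exact: (integrableS (@measurable_itv01 R) m0x sub (FG i).1).
Qed.

Lemma Rintegral_deriv_poly (p : {poly R}) (a x : R) : a <= x ->
  \int[mu]_(t in `[a, x]) (p^`()).[t] = p.[x] - p.[a].
Proof.
rewrite le_eqVlt => /predU1P[->|ax].
  by rewrite set_itv1 Rintegral_set1 subrr.
rewrite /Rintegral (@continuous_FTC2 _ _ (horner p))//.
- by apply: continuous_subspaceT; exact: continuous_horner.
- split.
  + by move=> y _; exact: derivable_horner.
  + by apply: cvg_at_right_filter; exact: continuous_horner.
  + by apply: cvg_at_left_filter; exact: continuous_horner.
- by move=> y _; rewrite derivE.
Qed.

(** A polynomial cut off at two of its zeros is still absolutely continuous:
    the jumps of the cut-off are multiplied by 0. *)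
Lemma weak_deriv_cutoff (p : {poly R}) (a b M : R) :
  0 <= a -> a < b -> b <= 1 -> p.[a] = 0 -> p.[b] = 0 ->
  (forall x, `|\1_(`[a, b[%classic) x * (p^`()).[x]| <= M) ->
  weak_deriv (fun x => \1_(`[a, b[%classic) x * p.[x])
             (fun x => \1_(`[a, b[%classic) x * (p^`()).[x]).
Proof.
move=> a0 ab b1 pa pb qM.
have int01 : (mu : {measure set (measurableTypeR R) -> \bar R}).-integrable
    itv01 (EFin \o (fun x => \1_(`[a, b[%classic) x * (p^`()).[x])).
  apply: (bounded_integrable01 (M := M)) => //.
  by apply: measurable_funM; [exact: measurable_indic|exact: measurable_poly].
split=> // x; rewrite /itv01/= in_itv/= => /andP[x0 x1].
have -> : \1_(`[a, b[%classic) 0 * p.[0] = 0.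
  rewrite indicE; case: (boolP (_ \in _)); rewrite ?mul0r// inE/= in_itv/=.
  move=> /andP[a0' _]; have aE : a = 0 by apply/eqP; rewrite eq_le a0 a0'.
  by rewrite -[X in p.[X]]aE pa mulr0.
rewrite add0r; pose B : set R := `[a, b[%classic.
have -> : \int[mu]_(t in `[0, x]) (\1_B t * (p^`()).[t]) =
    \int[mu]_(t in `[0, x] `&` B) (p^`()).[t].
  rewrite Rintegral_mkcondr; apply: eq_Rintegral => t _.
  by rewrite patchE indicE; case: (t \in B); rewrite ?mul1r ?mul0r.
rewrite indicE.
have [xa|ax] := ltP x a.
  rewrite (_ : _ `&` _ = set0) ?Rintegral_set0.
    rewrite (_ : (x \in _) = false) ?mul0r//.
    by apply/negbTE; rewrite notin_setE/= in_itv/= leNgt xa.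
  apply/seteqP; split => // t; rewrite /B/= !in_itv/=.
  move=> [/andP[_ tx] /andP[at_ _]].
  by have := le_lt_trans (le_trans at_ tx) xa; rewrite ltxx.
have [xb|bx] := ltP x b.
  rewrite mem_set/= ?in_itv/= ?ax ?xb// mul1r.
  rewrite (_ : _ `&` _ = `[a, x]%classic) ?Rintegral_deriv_poly ?pa ?subr0//.
  apply/seteqP; split => t; rewrite /B/= !in_itv/=.
    by move=> [/andP[_ ->] /andP[-> _]].
  move=> /andP[at_ tx]; rewrite (le_trans a0 at_) tx at_; split => //=.
  exact: le_lt_trans tx xb.
rewrite (_ : (x \in _) = false) ?mul0r; last first.
  by apply/negbTE; rewrite notin_setE/= in_itv/= ltNge bx andbF.
rewrite (_ : _ `&` _ = `[a, b[%classic); last first.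
  apply/seteqP; split => t; rewrite /B/= !in_itv/=; first by move=> [].
  move=> /andP[at_ tb]; rewrite (le_trans a0 at_) at_ tb; split => //=.
  exact: le_trans (ltW tb) bx.
rewrite Rintegral_itv_bndo_bndc ?Rintegral_deriv_poly ?(ltW ab)// ?pa ?pb ?subrr//.
have cint : mu.-integrable `[a, b] (EFin \o (fun t => (p^`()).[t])).
  apply: continuous_compact_integrable; first exact: segment_compact.
  by apply: continuous_subspaceT; exact: continuous_horner.
by apply: integrableS cint => //; apply: subset_itvl; rewrite bnd_simp.
Qed.

End weak_derivatives.

Section polynomials.
Context (R : realType).
Implicit Types p s : {poly R}.

Lemma derivn_mul_expn p s m i : (i <= m)%N ->
  exists r, (p * s ^+ m)^`(i) = r * s ^+ (m - i).
Proof.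
elim: i => [|i IH] im; first by exists p; rewrite derivn0 subn0.
have [r rE] := IH (ltnW im).
rewrite derivnS rE; have -> : (m - i = (m - i.+1).+1)%N by rewrite subnSK.
set e := (m - i.+1)%N; exists (r^`() * s + r * (s^`() *+ e.+1)).
rewrite derivM deriv_exp/= exprS; ring.
Qed.

Lemma derivn_expn_root s m i x : (i < m)%N -> s.[x] = 0 ->
  ((s ^+ m)^`(i)).[x] = 0.
Proof.
move=> im sx; have [r] := derivn_mul_expn 1 s (ltnW im).
rewrite mul1r => ->; rewrite hornerM horner_exp sx expr0n subn_eq0 leqNgt im.
by rewrite mulr0.
Qed.

Lemma derivn_comp_affine p (a c : R) i :
  (p \Po (a *: 'X - c%:P))^`(i) = a ^+ i *: (p^`(i) \Po (a *: 'X - c%:P)).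
Proof.
elim: i => [|i IH]; first by rewrite !derivn0 expr0 scale1r.
have dl : (a *: 'X - c%:P)^`() = a%:P.
  by rewrite derivB derivZ derivX derivC subr0 -mul_polyC mulr1.
by rewrite !derivnS IH derivZ deriv_comp dl exprS -!mul_polyC polyCM; ring.
Qed.

Lemma horner_le_coef p x : 0 <= x <= 1 -> `|p.[x]| <= \sum_(i < size p) `|p`_i|.
Proof.
move=> /andP[x0 x1]; rewrite horner_coef (le_trans (ler_norm_sum _ _ _))//.
apply: ler_sum => i _; rewrite normrM ler_piMr// ger0_norm ?exprn_ge0//.
by rewrite exprn_ile1.
Qed.

End polynomials.

Section bumps.
Context (R : realType) (alpha k : nat) (h : R).
Hypotheses (k0 : (0 < k)%N) (h0 : 0 <= h) (h1 : h <= 1).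
Implicit Types (j : 'I_k).

(** The profile u^alpha (1 - u)^alpha on [0, 1]; all its derivatives of order
    less than alpha vanish at 0 and at 1. *)
Definition bump_poly : {poly R} := ('X * (1 - 'X)) ^+ alpha.

(** Stretching the profile to a bin multiplies the alpha-th derivative by
    k^alpha, and this factor cancels it. *)
Definition bump_height : R := h / k%:R ^+ alpha.

Definition scaled_bump j : {poly R} :=
  bump_height *: (bump_poly \Po (k%:R *: 'X - (j%:R)%:P)).

Definition bin j : set (measurableTypeR R) :=
  `[j%:R / k%:R, j.+1%:R / k%:R[%classic.

Definition bump j (x : measurableTypeR R) : R := \1_(bin j) x * (scaled_bump j).[x].

Let kR : 0 < k%:R :> R. Proof. by rewrite ltr0n. Qed.

Let kE : k%:R != 0 :> R. Proof. by rewrite gt_eqF. Qed.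

Lemma scaled_bump_derivn j i x : ((scaled_bump j)^`(i)).[x] =
  bump_height * k%:R ^+ i * (bump_poly^`(i)).[k%:R * x - j%:R].
Proof.
rewrite /scaled_bump derivnZ derivn_comp_affine !hornerZ horner_comp.
by rewrite hornerD hornerZ hornerX hornerN hornerC mulrA.
Qed.

Lemma bump_polyE u : bump_poly.[u] = (u * (1 - u)) ^+ alpha.
Proof. by rewrite horner_exp !hornerE. Qed.

Lemma binP j x : (x \in bin j) = (0 <= k%:R * x - j%:R < 1).
Proof.
apply/idP/idP; rewrite inE /bin/= in_itv/=.
  rewrite ler_pdivrMr// ltr_pdivlMr// -natr1 => /andP[h2 h3].
  by apply/andP; split; lra.
rewrite ler_pdivrMr// ltr_pdivlMr// -natr1 => /andP[h2 h3].
by apply/andP; split; lra.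
Qed.

Lemma bin_disjoint i j x : i != j -> x \in bin i -> x \in bin j -> False.
Proof.
wlog ij : i j / (i < j)%N.
  move=> W ij xi xj; have [l|l|/val_inj e] := ltngtP i j.
  - exact: (W i j).
  - by apply: (W j i) => //; rewrite eq_sym.
  - by rewrite e eqxx in ij.
move=> _; rewrite !binP => /andP[_ h2] /andP[h3 _].
have : (i.+1%:R : R) <= j%:R by rewrite ler_nat.
by rewrite -natr1; lra.
Qed.

Lemma bin_sum_le (c : 'I_k -> R) (M : R) x : 0 <= M ->
  (forall j, x \in bin j -> `|c j| <= M) ->
  `|\sum_j c j * \1_(bin j) x| <= M.
Proof.
move=> M0 cM; have [[j xj]|none] := pselect (exists j, x \in bin j).
  rewrite (bigD1 j)//= big1 => [|i ij].
    by rewrite addr0 indicE xj mulr1 cM.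
  rewrite indicE; case: (boolP (x \in bin i)) => [xi|_]; last by rewrite mulr0.
  by case: (bin_disjoint ij xi xj).
rewrite big1 ?normr0// => j _; rewrite indicE.
by case: (boolP (x \in bin j)) => [xj|_]; [case: none; exists j|rewrite mulr0].
Qed.

Lemma measurable_bin j : measurable (bin j).
Proof. exact: measurable_itv. Qed.

Lemma measurable_bump j : measurable_fun setT (bump j).
Proof.
apply: measurable_funM; last exact: measurable_poly.
by apply: measurable_indic; exact: measurable_bin.
Qed.

Lemma bump_height_ge0 : 0 <= bump_height.
Proof. by rewrite divr_ge0 ?exprn_ge0. Qed.

Lemma bump_height_le : bump_height <= h.
Proof.
by rewrite /bump_height ler_pdivrMr ?exprn_gt0// ler_peMr// exprn_ege1// ler1n.
Qed.

Lemma bumps_disjoint i j x : i != j -> bump i x * bump j x = 0.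
Proof.
move=> ij; rewrite /bump !indicE.
case: (boolP (x \in bin i)) => [xi|_]; last by rewrite !mul0r.
case: (boolP (x \in bin j)) => [xj|_]; last by rewrite !mul0r mulr0.
by case: (bin_disjoint ij xi xj).
Qed.

Lemma bump_le j x : `|bump j x| <= bump_height * \1_(bin j) x.
Proof.
rewrite /bump indicE; case: (boolP (x \in bin j)); last first.
  by rewrite mul0r mulr0 normr0.
rewrite binP => /andP[u0 u1]; rewrite mul1r mulr1.
have := scaled_bump_derivn j 0 x; rewrite !derivn0 expr0 mulr1 => ->.
rewrite bump_polyE normrM (ger0_norm bump_height_ge0) ler_piMr ?bump_height_ge0//.
set u := _ - _ in u0 u1 *.
have u2 : 0 <= u * (1 - u) by rewrite mulr_ge0//; lra.
by rewrite ger0_norm ?exprn_ge0// exprn_ile1//; nra.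
Qed.

Lemma bump_norm_le1 j x : `|bump j x| <= 1.
Proof.
apply: (le_trans (bump_le j x)); apply: (le_trans _ h1).
apply: le_trans bump_height_le.
by rewrite ler_piMr ?bump_height_ge0// indicE; case: (_ \in _).
Qed.

(** On the middle half of the bin u (1 - u) >= 3 / 16. *)
Lemma bump_mass j :
  bump_height ^+ 2 * ((3 / 16) ^+ alpha) ^+ 2 / (2 * k%:R) <=
  \int[lebesgue_measure]_(x in itv01) bump j x ^+ 2.
Proof.
pose c := bump_height * (3 / 16) ^+ alpha.
pose mid : set (measurableTypeR R) :=
  `[(j%:R + 1 / 4) / k%:R, (j%:R + 3 / 4) / k%:R]%classic.
have mmid : measurable mid by exact: measurable_itv.
have jk : (j%:R + 1 : R) <= k%:R by rewrite natr1 ler_nat.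
have j0 : 0 <= j%:R :> R by [].
have midsub : mid `<=` (itv01 : set R).
  move=> x; rewrite /mid /itv01/= !in_itv/= ler_pdivrMr// ler_pdivlMr//.
  move=> /andP[x0 x1]; apply/andP; split.
    by rewrite -(ler_pM2r kR) mul0r; lra.
  by rewrite -(ler_pM2r kR) mul1r; lra.
have int2 : lebesgue_measure.-integrable itv01
    (EFin \o (fun x => bump j x ^+ 2)).
  apply: (bounded_integrable01 (M := 1)).
    by apply: measurable_funX; exact: measurable_bump.
  by move=> x; rewrite normrX expr_le1// bump_norm_le1.
have -> : bump_height ^+ 2 * ((3 / 16) ^+ alpha) ^+ 2 / (2 * k%:R) =
    \int[lebesgue_measure]_(x in itv01) (c ^+ 2 * \1_mid x).
  rewrite RintegralZl; last 2 first.
  - exact: measurable_itv01.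
  - apply: (bounded_integrable01 (M := 1)); first exact: measurable_indic.
    by move=> x; rewrite indicE; case: (_ \in _); rewrite ?normr1 ?normr0.
  rewrite (_ : bump_height ^+ 2 * _ = c ^+ 2); last first. by rewrite /c [RHS](exprMn 2).
  congr (_ * _).
  rewrite /Rintegral integral_indic//; last exact: measurable_itv01.
  rewrite setIidl// [X in fine X](@lebesgue_measure_itv R `[_, _])/= lte_fin.
  rewrite ltr_pM2r ?invr_gt0// ifT/=; last by lra.
  by field.
apply: le_Rintegral => //.
- exact: measurable_itv01.
- apply: (bounded_integrable01 (M := c ^+ 2)).
    by apply: measurable_funM => //; exact: measurable_indic.
  move=> x; rewrite normrM ger0_norm ?sqr_ge0// ler_piMr ?sqr_ge0// indicE.
  by case: (_ \in _); rewrite ?normr1 ?normr0.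
move=> x _; rewrite indicE; case: (boolP (x \in mid)); last first.
  by rewrite mulr0 sqr_ge0.
rewrite inE /mid/= in_itv/= ler_pdivrMr// ler_pdivlMr// => /andP[x0 x1].
have xb : x \in bin j by rewrite binP; apply/andP; split; lra.
rewrite mulr1 /bump indicE xb mul1r.
have := scaled_bump_derivn j 0 x; rewrite !derivn0 expr0 mulr1 => ->.
set u := _ - _.
have u1 : 1 / 4 <= u by rewrite /u; lra.
have u3 : u <= 3 / 4 by rewrite /u; lra.
have uu : 3 / 16 <= u * (1 - u) by nra.
have uu0 : 0 <= u * (1 - u) by apply: le_trans uu; lra.
have H0 := bump_height_ge0.
have c0 : 0 <= c by rewrite /c mulr_ge0.
rewrite bump_polyE ler_sqr ?nnegrE//; last by rewrite mulr_ge0// exprn_ge0.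
rewrite /c ler_wpM2l// lerXn2r ?nnegrE//.
Qed.

Lemma bin_mass j : (design R (bin j) <= (k%:R^-1)%:E)%E.
Proof.
have mb := measurable_bin j; rewrite designE//.
apply: (@le_trans _ _ (lebesgue_measure (bin j))).
  apply: le_measure; rewrite ?inE; [|exact: mb|exact: subIsetl].
  by apply: measurableI; [exact: mb|exact: measurable_itv01].
rewrite [leLHS](@lebesgue_measure_itv R `[_, _[)/= lte_fin.
case: ifP => _; last by rewrite lee_fin invr_ge0.
by rewrite -EFinB lee_fin -mulrBl -natr1 addrAC subrr add0r mul1r.
Qed.

Lemma signed_bumps_flip (th : {ffun 'I_k -> bool}) j x :
  `|signed_sum bump th x - signed_sum bump (flip j th) x| <=
  2 * bump_height * \1_(bin j) x.
Proof.
rewrite /signed_sum -sumrB (bigD1 j)//= big1 => [|i ij]; last first.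
  by rewrite ffunE (negbTE ij) subrr.
rewrite addr0 -mulrBl normrM ffunE eqxx -mulrA.
apply: ler_pM => //; last exact: bump_le.
rewrite /sgnb; case: (th j) => /=; first by rewrite opprK ger0_norm.
by rewrite -opprD normrN ger0_norm.
Qed.

Definition deriv_bound i : R := \sum_(l < size (bump_poly^`(i))) `|bump_poly^`(i)`_l|.

Lemma deriv_bound_ge0 i : 0 <= deriv_bound i.
Proof. exact: sumr_ge0. Qed.

Lemma scaled_bump_derivn_le j i x : x \in bin j ->
  `|((scaled_bump j)^`(i)).[x]| <= bump_height * k%:R ^+ i * deriv_bound i.
Proof.
rewrite binP => /andP[u0 u1]; rewrite scaled_bump_derivn normrM ger0_norm.
  rewrite ler_wpM2l ?mulr_ge0 ?bump_height_ge0 ?exprn_ge0//.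
  by apply: horner_le_coef; rewrite u0 ltW.
by rewrite mulr_ge0 ?bump_height_ge0 ?exprn_ge0.
Qed.

Lemma scaled_bump_derivn_root j i : (i < alpha)%N ->
  ((scaled_bump j)^`(i)).[j%:R / k%:R] = 0 /\
  ((scaled_bump j)^`(i)).[j.+1%:R / k%:R] = 0.
Proof.
move=> ia; rewrite !scaled_bump_derivn ![k%:R * (_ / _)]mulrC !divfK// subrr.
rewrite -natr1 addrAC subrr add0r /bump_poly !derivn_expn_root// ?mulr0//.
  by rewrite !hornerE subrr.
by rewrite !hornerE.
Qed.

Lemma bin_sub01 j : 0 <= j%:R / k%:R :> R /\ j.+1%:R / k%:R <= 1 :> R.
Proof.
split; first by rewrite divr_ge0.
by rewrite ler_pdivrMr// mul1r ler_nat.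
Qed.

(** The derivatives of order i < alpha are sums of cut-off polynomials which
    vanish at the ends of the bins. On each bin only one bump is nonzero, so f
    is bounded by h and its alpha-th derivative by h times a bound on the
    alpha-th derivative of the profile. *)
Lemma signed_bumps_sobolev (th : {ffun 'I_k -> bool}) (C : R) :
  h ^+ 2 * (1 + deriv_bound alpha ^+ 2) <= C ^+ 2 ->
  periodic_sobolev alpha C (signed_sum bump th).
Proof.
move=> hC; pose D i x := \sum_j sgnb R (th j) *
  (\1_(bin j) x * ((scaled_bump j)^`(i)).[x]).
have sgn1 b : `|sgnb R b| = 1 by rewrite /sgnb; case: b; rewrite ?normrN normr1.
have DE i x : D i x = \sum_j (sgnb R (th j) * ((scaled_bump j)^`(i)).[x]) *
    \1_(bin j) x by apply: eq_bigr => j _; ring.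
have Dle i x : `|D i x| <= bump_height * k%:R ^+ i * deriv_bound i.
  rewrite DE; apply: bin_sum_le.
    by rewrite !mulr_ge0 ?bump_height_ge0 ?exprn_ge0 ?deriv_bound_ge0.
  by move=> j xj; rewrite normrM sgn1 mul1r; exact: scaled_bump_derivn_le.
have mD i : measurable_fun setT (D i : measurableTypeR R -> R).
  apply: measurable_sum => j; apply: measurable_funM => //.
  apply: measurable_funM; last exact: measurable_poly.
  by apply: measurable_indic; exact: measurable_bin.
have D0le x : `|D 0%N x| <= h.
  rewrite /D (_ : \sum_j _ = \sum_j (sgnb R (th j) * bump j x) * \1_(bin j) x).
    apply: bin_sum_le => // j xj; rewrite normrM sgn1 mul1r.
    apply: (le_trans (bump_le j x)); rewrite indicE xj mulr1.
    exact: bump_height_le.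
  apply: eq_bigr => j _; rewrite /bump indicE; case: (_ \in _) => /=; ring.
exists D => //; split.
- move=> i ia; apply: weak_deriv_sum => j; rewrite /=.
  have [a0 b1] := bin_sub01 j.
  have [pa pb] := scaled_bump_derivn_root j ia.
  apply: (weak_deriv_cutoff (M := bump_height * k%:R ^+ i.+1 * deriv_bound i.+1)) => //.
    by rewrite ltr_pM2r ?invr_gt0// ltr_nat.
  move=> x; rewrite -/(bin j) indicE; case: (boolP (x \in bin j)) => xj.
    by rewrite mul1r; exact: (scaled_bump_derivn_le i.+1 xj).
  rewrite mul0r normr0 !mulr_ge0 ?bump_height_ge0 ?deriv_bound_ge0//.
- move=> i ia; rewrite /D !big1// => j _.
    rewrite indicE; case: (boolP (1 \in bin j)) => [|_]; last by rewrite mul0r mulr0.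
    rewrite inE /bin/= in_itv/= => /andP[_]; have [_] := bin_sub01 j.
    by move=> /le_lt_trans /[apply]; rewrite ltxx.
  rewrite indicE; case: (boolP (0 \in bin j)) => [|_]; last by rewrite mul0r mulr0.
  rewrite inE /bin/= in_itv/= => /andP[j0 _].
  have [pa _] := scaled_bump_derivn_root j ia.
  have zE : j%:R / k%:R = 0 :> R.
    by apply/eqP; rewrite eq_le j0 (bin_sub01 j).1.
  by move: pa; rewrite zE => ->; rewrite !mulr0.
- apply: (@le_trans _ _ (\int[lebesgue_measure]_(x in itv01)
      (cst (h ^+ 2 * (1 + deriv_bound alpha ^+ 2))%:E x))%E).
    apply: ge0_le_integral => //.
    + exact: measurable_itv01.
    + by move=> x _; rewrite lee_fin addr_ge0 ?sqr_ge0.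
    + apply/measurable_EFinP/measurable_funTS/measurable_funD.
        by apply: measurable_funX; exact: (mD 0%N).
      by apply: measurable_funX; exact: mD.
    move=> x _; rewrite lee_fin mulrDr mulr1 lerD//.
      by rewrite -real_normK ?num_real// ler_sqr ?nnegrE//; exact: D0le.
    rewrite -exprMn -real_normK ?num_real// ler_sqr ?nnegrE//; last first.
      by rewrite mulr_ge0// deriv_bound_ge0.
    by have := Dle alpha x; rewrite /bump_height divfK// expf_neq0.
  rewrite integral_cst; last exact: measurable_itv01.
  by rewrite [X in (_ * X)%E]lebesgue_itv01 mule1 lee_fin.
Qed.

End bumps.

(** * The lower bound *)

(** Take k = floor(x) + 1 with x = y^(1/m). Since x is bounded away from 0, k is
    at most a constant multiple of x. *)
Lemma bin_number (R : realType) (a m : nat) (y0 : R) : (0 < m)%N -> 0 < y0 ->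
  exists2 c : R, 0 < c & forall y, y0 <= y -> exists k : nat,
    [/\ (0 < k)%N, y <= k%:R ^+ m &
        c * y `^ (- (2 * a%:R / m%:R)) <= (k%:R ^+ (2 * a)) ^-1].
Proof.
move=> m0 y00; have mR : m%:R != 0 :> R by rewrite pnatr_eq0 -lt0n.
pose K := 1 + (y0 `^ m%:R^-1)^-1.
have x0 : 0 < y0 `^ m%:R^-1 by exact: powR_gt0.
have K0 : 0 < K by rewrite ltr_wpDr// invr_ge0 ltW.
exists (K ^+ (2 * a))^-1; first by rewrite invr_gt0 exprn_gt0.
move=> y yy0; have y_gt0 : 0 < y by exact: lt_le_trans yy0.
pose x := y `^ m%:R^-1.
have xpos : 0 < x by exact: powR_gt0.
have x0x : y0 `^ m%:R^-1 <= x 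
  by apply: ge0_ler_powR => //; rewrite ?nnegrE ?invr_ge0// ltW.
exists (Num.truncn x).+1; split=> //.
  have -> : y = x ^+ m.
    by rewrite -powR_mulrn ?powR_ge0// /x -powRrM mulVf// powRr1// ltW.
  by rewrite lerXn2r ?nnegrE ?(ltW xpos)// ltW// truncnS_gt.
have kx : (Num.truncn x).+1%:R <= x * K.
  rewrite -natr1 mulrDr mulr1 lerD//; first by rewrite truncn_le// ltW.
  by rewrite ler_pdivlMr// mul1r.
rewrite powRN -invfM lef_pV2 ?posrE; last 2 first.
- by rewrite mulr_gt0 ?exprn_gt0 ?powR_gt0.
- by rewrite exprn_gt0.
have -> : y `^ (2 * a%:R / m%:R) = x ^+ (2 * a).
  by rewrite -powR_mulrn ?powR_ge0// /x -powRrM natrM mulrC.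
by rewrite -exprMn mulrC lerXn2r ?nnegrE// ltW// mulr_gt0.
Qed.

Section lower_bound.
Context (R : realType) (alpha : nat) (C sigma_min h : R).
Hypotheses (h0 : 0 < h) (h1 : h <= 1).
Hypothesis hC : h ^+ 2 * (1 + deriv_bound R alpha alpha ^+ 2) <= C ^+ 2.
Hypotheses (smin0 : 0 < sigma_min) (hs : 64 * h <= sigma_min).

(** The factor 1 / 64 between [h] and [sigma_min] makes both testing bounds at
    most 1 / 2; [s] is chosen so that 1 + s^2 dominates the chi-square bound
    exp(t) <= 1 + 2 t, where t = (2 H / sigma)^2. *)
Lemma sup_risk_ge (k n : nat) (sigma eps delta : R)
    (M : R.-pker (n.-tuple (obs R)) ~> (L2 R)) :
  (0 < k)%N -> sigma_min <= sigma -> 0 < eps < 1 -> delta <= eps ->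
  diff_private eps delta M ->
  n%:R * eps <= k%:R ^+ (alpha + 1) \/ n%:R <= k%:R ^+ (2 * alpha + 1) :> R ->
  ((h ^+ 2 * ((3 / 16) ^+ alpha) ^+ 2 / 8 * (k%:R ^+ (2 * alpha))^-1)%:E <=
    ereal_sup [set risk sigma M f | f in periodic_sobolev alpha C])%E.
Proof.
move=> k0 ss eps01 de dp nk.
have sigma_gt0 : 0 < sigma by exact: lt_le_trans ss.
have sigma0 : sigma != 0 by rewrite gt_eqF.
have kR : 0 < k%:R :> R by rewrite ltr0n.
have h_ge0 := ltW h0.
pose H := bump_height alpha k h.
have H0 : 0 < H by rewrite divr_gt0// exprn_gt0.
pose psi := @bump R alpha k h.
pose s := 4 * H / sigma.
have s0 : 0 < s by rewrite divr_gt0// mulr_gt0.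
have hs' : 64 * h <= sigma by exact: le_trans ss.
have hsig : h / sigma <= 1 / 64 by rewrite ler_pdivrMr//; lra.
have hsig0 : 0 <= h / sigma by rewrite divr_ge0// ltW.
have sE : s = 4 * (h / sigma) / k%:R ^+ alpha by rewrite /s /H /bump_height; ring.
have Hs : H / sigma <= 1 / 64.
  apply: le_trans hsig; rewrite ler_pM2r ?invr_gt0//.
  exact: bump_height_le.
have Hs0 : 0 <= H / sigma by rewrite divr_ge0 ?ltW.
have As : expR ((2 * H) ^+ 2 / sigma ^+ 2) <= 1 + s ^+ 2.
  rewrite (_ : _ / _ = 4 * (H / sigma) ^+ 2); last by field.
  apply: (le_trans (expR_le_1D2x _)).
    by rewrite mulr_ge0 ?sqr_ge0//=; nra.
  by rewrite /s -mulrA exprMn; have := sqr_ge0 (H / sigma); lra.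
have mpsi := measurable_bump alpha h (k := k).
have [th thr] : exists th, ((bump_height alpha k h ^+ 2 *
    ((3 / 16) ^+ alpha) ^+ 2 / (2 * k%:R) * (k%:R / 4))%:E <=
    risk sigma M (signed_sum psi th))%E.
  apply: (assouad_risk (mpsi := mpsi)).
  - by move=> j x; exact: bump_norm_le1.
  - by move=> i j x; exact: bumps_disjoint.
  - by rewrite !(mulr_ge0, invr_ge0, sqr_ge0).
  - by move=> j; exact: bump_mass.
  move=> th j S mS.
  have flipH x : `|signed_sum psi th x - signed_sum psi (flip j th) x| <=
      2 * H * \1_(bin j) x by exact: signed_bumps_flip.
  case: nk => nk.
    apply: (@two_points_private R sigma sigma0 _ _ (measurable_signed_sum mpsi th)
      (measurable_signed_sum mpsi (flip j th)) _ _ _ (measurable_bin j)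
      (bin_mass R j) flipH s s0 As n eps delta M S eps01 de _ dp mS).
    rewrite (_ : _ * _ = 32 * (h / sigma) * (n%:R * eps / k%:R ^+ (alpha + 1))).
      have : n%:R * eps / k%:R ^+ (alpha + 1) <= 1.
        by rewrite ler_pdivrMr ?mul1r ?exprn_gt0.
      have : 0 <= n%:R * eps / k%:R ^+ (alpha + 1).
        by case/andP: eps01 => e0 _; rewrite divr_ge0 ?exprn_ge0// mulr_ge0// ltW.
      by nra.
    by rewrite sE addn1 exprS; field; rewrite sigma0 !gt_eqF ?exprn_gt0.
  apply: (@two_points_chi2 R sigma sigma0 _ _ (measurable_signed_sum mpsi th)
    (measurable_signed_sum mpsi (flip j th)) _ _ _ (measurable_bin j)
    (bin_mass R j) flipH s As).
  - by rewrite invr_ge0.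
  - rewrite (_ : _ * _ = 16 * (h / sigma) ^+ 2 * (n%:R / k%:R ^+ (2 * alpha + 1))).
      have : n%:R / k%:R ^+ (2 * alpha + 1) <= 1 :> R.
        by rewrite ler_pdivrMr ?mul1r ?exprn_gt0.
      have : 0 <= n%:R / k%:R ^+ (2 * alpha + 1) :> R by rewrite divr_ge0 ?exprn_ge0.
      have : (h / sigma) ^+ 2 <= 1 / 64 by nra.
      by have := sqr_ge0 (h / sigma); nra.
    rewrite sE addn1 mulnC (exprS k%:R (alpha * 2)) (exprM k%:R alpha 2).
    by field; rewrite sigma0 !gt_eqF ?exprn_gt0.
  - exact: test_kernel.
apply: (@le_trans _ _ (risk sigma M (signed_sum psi th))).
  apply: le_trans thr; rewrite lee_fin le_eqVlt; apply/orP; left; apply/eqP.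
  rewrite /bump_height mulnC exprM.
  by field; rewrite !gt_eqF ?exprn_gt0.
apply: ereal_sup_ubound; exists (signed_sum psi th) => //.
exact: signed_bumps_sobolev.
Qed.

End lower_bound.

Theorem theorem6p1 (R : realType) (alpha : nat) (C sigma_min sigma_max c1 : R)
    (alpha_ge1 : (1 <= alpha)%N) (C_gt0 : 0 < C)
    (sigma_min_gt0 : 0 < sigma_min) (sigma_minmax : sigma_min <= sigma_max)
    (c1_gt0 : 0 < c1) :
  exists c c' : R, [/\ 0 < c, 0 < c' &
    forall (sigma : R) (n : nat) (eps delta : R),
      sigma_min <= sigma <= sigma_max ->
      0 < eps < 1 -> 0 < delta < c * n%:R ^- 2 -> c1 <= n%:R * eps ->
      ((c' * (n%:R `^ (- (2 * alpha%:R / (2 * alpha%:R + 1)))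
              + (n%:R * eps) `^ (- (2 * alpha%:R / (alpha%:R + 1)))))%:E
        <= private_minimax_risk n sigma eps delta alpha C)%E].
Proof.
have [ca ca0 rate_np] := @bin_number R alpha (2 * alpha + 1) 1
  (ltn_addl _ (ltn0Sn 0)) ltr01.
have [cb cb0 rate_p] := @bin_number R alpha (alpha + 1) c1
  (ltn_addl _ (ltn0Sn 0)) c1_gt0.
pose L := 1 + deriv_bound R alpha alpha ^+ 2.
have L1 : 1 <= L by rewrite lerDl sqr_ge0.
have L0 : 0 < L by exact: lt_le_trans L1.
pose h := Num.min 1 (Num.min (C / L) (sigma_min / 64)).
have h0 : 0 < h by rewrite /h !lt_min ltr01 !divr_gt0.
have h1 : h <= 1 by rewrite /h ge_min lexx.
have hs : 64 * h <= sigma_min.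
  have : h <= sigma_min / 64 by rewrite /h !ge_min lexx !orbT.
  lra.
have hC : h ^+ 2 * L <= C ^+ 2.
  have hCL : h <= C / L by rewrite /h !ge_min lexx orbT.
  apply: (@le_trans _ _ ((C / L) ^+ 2 * L)).
    by rewrite ler_pM2r// ler_sqr ?nnegrE ?divr_ge0// ltW.
  rewrite (_ : _ * L = C ^+ 2 / L); last by field; rewrite gt_eqF.
  by rewrite ler_pdivrMr// ler_peMr ?sqr_ge0.
pose c0 := h ^+ 2 * ((3 / 16) ^+ alpha) ^+ 2 / 8.
have c00 : 0 < c0 by rewrite divr_gt0// mulr_gt0 ?exprn_gt0//; lra.
exists c1, (c0 / 2 * Num.min ca cb); split=> //.
  by apply: mulr_gt0; [exact: divr_gt0|rewrite lt_min ca0].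
move=> sigma n eps delta /andP[ss _] eps01 /andP[delta0 deltac] neps.
have /andP[eps0 eps1] := eps01.
have n0 : (0 < n)%N.
  by rewrite lt0n; apply: contraTneq neps => ->; rewrite mul0r -ltNge.
have nR : 1 <= n%:R :> R by rewrite ler1n.
have de : delta <= eps.
  apply: (le_trans (ltW deltac)); rewrite -[_ ^- 2]/((_ ^+ 2)^-1).
  rewrite ler_pdivrMr ?exprn_gt0 ?(lt_le_trans ltr01)//.
  apply: (le_trans neps); rewrite mulrC ler_pM2l//.
  by rewrite expr2 ler_peMr// (le_trans ler01).
apply: le_ereal_inf_tmp => _ [M dp <-].
have [k1 [k10 yk1 ck1]] := rate_np n%:R nR.
have [k2 [k20 yk2 ck2]] := rate_p (n%:R * eps) neps.
have b1 := sup_risk_ge h0 h1 hC sigma_min_gt0 hs k10 ss eps01 de dp (or_intror yk1).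
have b2 := sup_risk_ge h0 h1 hC sigma_min_gt0 hs k20 ss eps01 de dp (or_introl yk2).
rewrite -/c0 in b1 b2; clearbody c0; move: ck1 ck2.
rewrite (_ : (2 * alpha + 1)%:R = 2 * alpha%:R + 1); last by rewrite natrD natrM.
rewrite (_ : (alpha + 1)%:R = alpha%:R + 1); last by rewrite natrD.
set A := n%:R `^ _; set B := (n%:R * eps) `^ _ => ck1 ck2.
have A0 : 0 <= A by exact: powR_ge0.
have B0 : 0 <= B by exact: powR_ge0.
have mA : Num.min ca cb * A <= ca * A by rewrite ler_wpM2r// ge_min lexx.
have mB : Num.min ca cb * B <= cb * B by rewrite ler_wpM2r// ge_min lexx orbT.
have [AB|AB] := leP (cb * B) (ca * A).
  apply: le_trans b1; rewrite lee_fin -!mulrA ler_pM2l//; lra.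
apply: le_trans b2; rewrite lee_fin -!mulrA ler_pM2l//; lra.
Qed.
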